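(* Let $p$ be a prime, $m\ge 1$, $q=p^m$, and let $\nu_p$ denote the $p$-adic valuation. Let $n\ge 1$, $d\ge 2$, and let $$f=\sum_{\boldsymbol u\in U_d}a_{\boldsymbol u}\boldsymbol X^{\boldsymbol u}\in\mathbb F_q[X_1,\dots,X_n],$$ where $\boldsymbol X=(X_1,\dots,X_n)$, and let $Z(f)=\{\boldsymbol x\in\mathbb F_q^n: f(\boldsymbol x)=0\}$. Define $$E(f)=(-1)^{n+m\lceil n/d\rceil}\Bigl[-\sum_{i\in\mathcal I}\ \prod_{\boldsymbol u\in U_d}\frac{a_{\boldsymbol u}^{i(\boldsymbol u)}}{\gamma(i(\boldsymbol u))}+(-1)^m\sum_{i\in\mathcal I'}\ \prod_{\boldsymbol u\in U_d}\frac{a_{\boldsymbol u}^{i(\boldsymbol u)}}{\gamma(i(\boldsymbol u))}\Bigr]\in\mathbb F_q,$$ where $\mathcal I$, $\mathcal I'$ and $\gamma$ are as defined in the context. Then $E(f)\in\mathbb F_p$ and $$|Z(f)|\equiv q^{\lceil n/d\rceil-1}E(f)\pmod{q^{\lceil n/d\rceil-1}p}.$$ In particular, $\nu_p(|Z(f)|)\ge m(\lceil n/d\rceil-1)+1$ if and only if $E(f)=0$.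
   Context: $U_d=\{\boldsymbol u\in\mathbb N^n: |\boldsymbol u|\le d\}$, where $\mathbb N$ includes $0$ and $|\boldsymbol u|=u_1+\cdots+u_n$; $\boldsymbol X^{\boldsymbol u}=X_1^{u_1}\cdots X_n^{u_n}$. For an integer $a\in\{0,\dots,q-1\}$ write its base $p$ expansion as $a=a^{(0)}+a^{(1)}p+\cdots+a^{(m-1)}p^{m-1}$ with $0\le a^{(j)}\le p-1$; set $\gamma(a)=a^{(0)}!\,a^{(1)}!\cdots a^{(m-1)}!$, which is prime to $p$ and hence invertible in $\mathbb F_p$. The convention $0^0=1$ is used. For a function $i:U_d\to\{0,\dots,q-1\}$, $i(\boldsymbol u)^{(j)}$ denotes the $j$-th base $p$ digit of $i(\boldsymbol u)$. $\mathcal I$ is the set of functions $i:U_d\to\{0,\dots,q-1\}$ such that (i) each component of $\sum_{\boldsymbol u\in U_d}i(\boldsymbol u)\boldsymbol u\in\mathbb N^n$ is a positive multiple of $q-1$; and (ii) $\sum_{\boldsymbol u\in U_d}i(\boldsymbol u)^{(j)}=(p-1)\lceil n/d\rceil$ for all $0\le j\le m-1$. If $d\mid n-1$, $\mathcal I'$ is the set of functions $i:U_d\to\{0,\dots,q-1\}$, not identically zero, such that (i) one of the components of $\sum_{\boldsymbol u\in U_d}i(\boldsymbol u)\boldsymbol u$ is $0$ and the other components are all positive multiples of $q-1$; and (ii) $\sum_{\boldsymbol u\in U_d}i(\boldsymbol u)^{(j)}=(p-1)(n-1)/d$ for all $0\le j\le m-1$. If $d\nmid n-1$, $\mathcal I'=\emptyset$.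 The congruence for $|Z(f)|$ means: it holds with $E(f)\in\mathbb F_p$ replaced by any integer whose class modulo $p$ is $E(f)$. The valuation of $0$ is $\nu_p(0)=\infty$. *)

(* Defs.v *)
From HB Require Import structures.
From mathcomp Require Import all_boot all_order all_algebra.
From mathcomp.multinomials Require Import mpoly.

Set Implicit Arguments.
Unset Strict Implicit.
Unset Printing Implicit Defensive.

Import GRing.Theory.
Local Open Scope ring_scope.

(* U_d: exponent vectors u in N^n with |u| <= d; the bound of the library type
   is strict, hence d.+1. *)
Definition expts (n d : nat) : finType := 'X_{1..n < d.+1}.

(* ceil(n / d), for d > 0 *)
Definition ceil_div (n d : nat) : nat := ((n + d.-1) %/ d)%N.

(* the digit a^(j) of a in base p *)
Definition digit (p a j : nat) : nat := ((a %/ p ^ j) %% p)%N.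

Definition gam (p m a : nat) : nat := (\prod_(j < m) (digit p a j)`!)%N.

(* the k-th component of the sum of the vectors i(u) u *)
Definition wsum (n d N : nat) (i : {ffun expts n d -> 'I_N}) (k : 'I_n) : nat :=
  (\sum_(u : expts n d) i u * u k)%N.

Definition digit_sum (p n d N : nat) (i : {ffun expts n d -> 'I_N}) (j : nat)
  : nat := (\sum_(u : expts n d) digit p (i u) j)%N.

Definition pos_multiple (e s : nat) : bool := (0 < s)%N && (e %| s)%N.

Definition I_set (p m n d : nat) : {set {ffun expts n d -> 'I_(p ^ m)}} :=
  [set i : {ffun expts n d -> 'I_(p ^ m)} |
     [forall k : 'I_n, pos_multiple (p ^ m).-1 (wsum i k)]
  && [forall j : 'I_m, digit_sum p i j == (p.-1 * ceil_div n d)%N]].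

(* The condition d %| n.-1 makes this set empty when d does not divide n - 1. *)
Definition I'_set (p m n d : nat) : {set {ffun expts n d -> 'I_(p ^ m)}} :=
  [set i : {ffun expts n d -> 'I_(p ^ m)} |
    [&& (d %| n.-1)%N,
        [exists u : expts n d, (i u : nat) != 0%N],
        [exists k : 'I_n, (wsum i k == 0%N) &&
           [forall l : 'I_n, (l != k) ==> pos_multiple (p ^ m).-1 (wsum i l)]]
      & [forall j : 'I_m, digit_sum p i j == (p.-1 * (n.-1 %/ d))%N]]].

Definition poly_of (F : finFieldType) (n d : nat) (a : expts n d -> F)
  : {mpoly F[n]} := \sum_(u : expts n d) a u *: 'X_[u].

Definition zeros (F : finFieldType) (n : nat) (f : {mpoly F[n]})
  : {set {ffun 'I_n -> F}} := [set x : {ffun 'I_n -> F} | f.@[x] == 0].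

Definition E_term (F : finFieldType) (p m n d : nat) (a : expts n d -> F)
    (i : {ffun expts n d -> 'I_(p ^ m)}) : F :=
  \prod_(u : expts n d) (a u ^+ i u / (gam p m (i u))%:R).

(* E(f), as a function of the coefficients a of f = poly_of a *)
Definition E_of (F : finFieldType) (p m n d : nat) (a : expts n d -> F) : F :=
  (-1) ^+ (n + m * ceil_div n d) *
  (- (\sum_(i in I_set p m n d) E_term a i)
   + (-1) ^+ m * (\sum_(i in I'_set p m n d) E_term a i)).

(* The p-adic valuation on nat, with None standing for the value infinity
   taken at 0 (logn p 0 = 0 in the library). *)
Definition padic_val (p N : nat) : option nat :=
  if N == 0%N then None else Some (logn p N).

(* k <= v, for v a natural number or infinity *)
Definition le_val (k : nat) (v : option nat) : bool :=
  if v is Some v' then (k <= v')%N else true.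

(* Main.v *)
From HB Require Import structures.
Require Import Defs.
From mathcomp Require Import all_boot all_order all_fingroup all_algebra.
From mathcomp Require Import all_solvable all_field zify ring.
From mathcomp.multinomials Require Import mpoly.

Set Implicit Arguments.
Unset Strict Implicit.
Unset Printing Implicit Defensive.

Import GRing.Theory.
Local Open Scope ring_scope.

(** The number of zeros is read off an exponential sum.  Let O be a local ring
    of characteristic 0 (up to a high power of p) with residue map theta onto
    F = F_q, whose maximal ideal is generated by lam = zeta - 1 for a p-th
    root of unity zeta; in it p = - lam^(p-1) up to factors congruent to 1.
    With psi(y) = zeta^(Tr y), orthogonality gives

      q |Z(f)| = \sum_x \sum_t psi (t f(x))
               = \sum_x \sum_t \prod_u psi (t a_u x^u).

    Let T be the Teichmueller lift.  By Fourier inversion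
    psi(y) = \sum_(j < q) C_j T(y)^j, where the C_j are essentially Gauss
    sums, and Stickelberger's congruence determines their leading terms:
    C_j = lam^s(j) c_j with theta(c_j) = 1 / gamma(j), where s(j) is the base-p
    digit sum ([add_char_expansion]).  Expanding the product over u, the
    function i : U_d -> {0, .., q-1} contributes

      \prod_u C_(i u) T(a_u)^(i u) * S(\sum_u i u) * \prod_k S(w_k(i)),

    with w(i) = \sum_u i(u) u and S(e) = \sum_t T(t)^e, which is q for e = 0,
    q - 1 for the other multiples of q - 1, and 0 otherwise.  The order in lam
    of a nonzero contribution is m (p-1) for each vanishing exponent e, plus
    the sum of the digit sums of the i(u).  Applying the divisibility
    conditions to all cyclic shifts of the digits of i bounds that sum from
    below ([ax_bound]).  Hence the order is at least m (p-1) ceil(n/d), and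
    the cases of equality are exactly the families of I (no w_k vanishes) and
    I' (one w_k vanishes) ([lam_order_bound]).  So
    q |Z(f)| = lam^(m (p-1) ceil(n/d)) Y with theta(Y) equal to E(f) up to the
    sign coming from q^ceil(n/d) ([card_zeros_leading]).  As |Z(f)| is an
    integer, it is q^(ceil(n/d) - 1) b with b = E(f) in F
    ([natr_lam_descent]); the three assertions follow.

    Stickelberger's congruence is proved by induction on digits: adding p^l to
    a without carry multiplies the Gauss sum by that of p^l, divided by a
    Jacobi sum which is a unit of known residue.

    The ring O is taken of finite length, so that Teichmueller lifts are plain
    powers: it is (Z/p^N)[zeta] extended by a root of a lift of the minimal
    polynomial of a generator of F ([ramified_lift_exists]).  The price is that
    O has zero divisors, and cancellation has to be justified by units. *)

(** * Base-p digits *)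

Definition digit_total (p m a : nat) : nat := (\sum_(j < m) digit p a j)%N.

Section Digits.
Local Open Scope nat_scope.
Variable p : nat.
Hypothesis p_gt1 : 1 < p.

Lemma digits_sum m a : a < p ^ m -> a = \sum_(j < m) digit p a j * p ^ j.
Proof.
elim: m a => [|m IH] a.
  by rewrite expn0 ltnS leqn0 => /eqP->; rewrite big_ord0.
move=> lt_a; rewrite big_ord_recl /digit expn0 divn1 muln1 [LHS](divn_eq a p).
have lt_ap : a %/ p < p ^ m by rewrite ltn_divLR ?(ltnW p_gt1) // -expnSr.
rewrite addnC; congr (_ + _).
rewrite [in LHS](IH _ lt_ap) big_distrl /=; apply: eq_bigr => j _.
by rewrite /digit -divnMA -expnS -mulnA -expnSr.
Qed.

Lemma digit_addX a l j :
  (digit p a l).+1 < p -> digit p (a + p ^ l) j = digit p a j + (j == l).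
Proof.
have p_gt0 : 0 < p by apply: ltnW.
rewrite /digit => lt_d; have [lt_jl|lt_lj|->] := ltngtP j l; last 1 first.
- rewrite divnDr // divnn expn_gt0 p_gt0 /= -modnDml modn_small //.
  by rewrite addn1.
- rewrite -(subnK (ltnW lt_jl)) expnD divnDr ?dvdn_mull // mulnK ?expn_gt0 ?p_gt0 //.
  have -> : l - j = (l - j).-1.+1 by lia.
  by rewrite addn0 expnS -modnDmr modnMr addn0.
- have [k ->] : exists k, j = l + k.+1 by exists (j - l).-1; lia.
  rewrite addn0 expnD expnS !divnMA; congr ((_ %/ _) %% _).
  rewrite divnDr // divnn expn_gt0 p_gt0 /=.
  rewrite {1}(divn_eq (a %/ p ^ l) p) -addnA divnMDl // [X in _ + X]divn_small //.
    by rewrite addn0.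
  by rewrite addn1.
Qed.

(** Every nonzero number below p^m arises from a smaller one by increasing a
    digit without carry; this is the induction step for Gauss sums. *)
Lemma sub_digit m a : 0 < a < p ^ m ->
  exists b l, [/\ l < m, a = b + p ^ l & (digit p b l).+1 < p].
Proof.
case/andP => a_gt0 lt_a; have p_gt0 : 0 < p by apply: ltnW.
have [l dl] : exists l : 'I_m, digit p a l != 0.
  apply/existsP; apply: contraLR a_gt0; rewrite negb_exists => /forallP d0.
  rewrite (digits_sum lt_a) big1 // => j _.
  by move: (d0 j); rewrite negbK => /eqP->.
have le_la : p ^ l <= a.
  rewrite leqNgt; apply: contra dl => lt_al.
  by rewrite /digit divn_small // mod0n.
exists (a - p ^ l), l; split; rewrite ?subnK //.
have : a %/ p ^ l = (a - p ^ l) %/ p ^ l + 1.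
  rewrite -{1}(subnK le_la) divnDr // divnn expn_gt0 p_gt0 //.
move: dl; rewrite /digit => + e; rewrite e; set b := _ %/ _; rewrite addn1 => nz.
have := ltn_pmod b p_gt0; rewrite leq_eqVlt => /orP[/eqP eb|//].
by case/negP: nz; rewrite -addn1 -modnDml addn1 eb modnn.
Qed.

Lemma digit_total_addX m a l : l < m -> (digit p a l).+1 < p ->
  digit_total p m (a + p ^ l) = (digit_total p m a).+1.
Proof.
move=> lt_lm lt_d; rewrite /digit_total.
under eq_bigr => j _ do rewrite (digit_addX _ lt_d).
rewrite big_split /= -addn1; congr (_ + _).
rewrite (bigD1 (Ordinal lt_lm)) //= eqxx big1 // => j.
by rewrite -val_eqE /= => /negPf->.
Qed.

Lemma gam_addX m a l : l < m -> (digit p a l).+1 < p ->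
  gam p m (a + p ^ l) = gam p m a * (digit p a l).+1.
Proof.
move=> lt_lm lt_d; rewrite /gam.
under eq_bigr => j _ do rewrite (digit_addX _ lt_d).
rewrite (bigD1 (Ordinal lt_lm)) //= [in RHS](bigD1 (Ordinal lt_lm)) //=.
rewrite eqxx addn1 factS mulnAC -mulnA mulnC -mulnA mulnC -!mulnA; congr (_ * _).
rewrite mulnC; congr (_ * _); apply: eq_bigr => j; rewrite -val_eqE /= => /negPf->.
by rewrite addn0.
Qed.

Lemma digit0 j : digit p 0 j = 0. Proof. by rewrite /digit div0n mod0n. Qed.

Lemma gam0 m : gam p m 0 = 1.
Proof. by rewrite /gam big1 // => j _; rewrite digit0. Qed.

Lemma digit_total0 m : digit_total p m 0 = 0.
Proof. by rewrite /digit_total big1 // => j _; rewrite digit0. Qed.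

Lemma digit_predX m (j : 'I_m) : digit p (p ^ m).-1 j = p.-1.
Proof.
have p_gt0 : 0 < p by apply: ltnW.
case: j => j /= lt_jm; rewrite /digit.
have [k ->] : exists k, m = k.+1 + j by exists (m - j).-1; lia.
have pj_gt0 : 0 < p ^ j by rewrite expn_gt0 p_gt0.
have pk_gt0 : 0 < p ^ k by rewrite expn_gt0 p_gt0.
have -> : (p ^ (k.+1 + j)).-1 = (p ^ k.+1).-1 * p ^ j + (p ^ j).-1.
  have : 0 < p ^ k.+1 by rewrite expn_gt0 p_gt0.
  by rewrite expnD; nia.
rewrite divnMDl // [X in _ + X]divn_small ?ltn_predL // addn0.
have -> : (p ^ k.+1).-1 = (p ^ k).-1 * p + p.-1.
  by rewrite expnSr; nia.
by rewrite modnMDl modn_small // ltn_predL.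
Qed.

Lemma digit_total_predX m : digit_total p m (p ^ m).-1 = m * p.-1.
Proof.
rewrite /digit_total (eq_bigr (fun=> p.-1)) => [|j _]; last exact: digit_predX.
by rewrite sum_nat_const card_ord.
Qed.

Lemma gam_predX m : gam p m (p ^ m).-1 = (p.-1)`! ^ m.
Proof.
rewrite /gam (eq_bigr (fun=> (p.-1)`!)) => [|j _]; last by rewrite digit_predX.
by rewrite prod_nat_const card_ord.
Qed.

End Digits.

(** * The lower bound for digit sums *)

Section AxBound.
Local Open Scope nat_scope.
Variables (p m : nat).
Hypotheses (p_gt1 : 1 < p) (m_gt0 : 0 < m).

(** The cyclic shift by j places of the m base-p digits of a < p^m.  It
    represents p^j a modulo p^m - 1, but fixes p^m - 1 instead of reducing it
    to 0, so that positive numbers stay positive. *)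
Definition rot_digits j a := a %/ p ^ (m - j) + p ^ j * (a %% p ^ (m - j)).

Lemma rot_digits0 a : a < p ^ m -> rot_digits 0 a = a.
Proof. by move=> lt_a; rewrite /rot_digits subn0 divn_small // modn_small // mul1n. Qed.

Lemma rot_digits_full a : rot_digits m a = a.
Proof. by rewrite /rot_digits subnn divn1 modn1 muln0 addn0. Qed.

(** Shifting by one more place multiplies by p and moves the overflowing top
    digit t from weight p^m to weight 1, a loss of t (p^m - 1). *)
Lemma rot_digitsS j a : j < m ->
  p * rot_digits j a = rot_digits j.+1 a + (p ^ m).-1 * digit p a (m - j.+1).
Proof.
move=> lt_jm; rewrite /rot_digits /digit.
have [k ek] : exists k, m - j = k.+1 by exists (m - j.+1); lia.
have ek' : m - j.+1 = k by lia.
rewrite ek ek' -[in p ^ m](subnK (ltnW lt_jm)) ek.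
have p_gt0 : 0 < p by apply: ltnW.
have pk_gt0 : 0 < p ^ k by rewrite expn_gt0 p_gt0.
have pj_gt0 : 0 < p ^ j by rewrite expn_gt0 p_gt0.
set t := _ %% p; have eA : a %/ p ^ k = a %/ p ^ k.+1 * p + t.
  by rewrite expnSr divnMA -divn_eq.
have eB : a %% p ^ k.+1 = t * p ^ k + a %% p ^ k.
  apply: (@addnI (a %/ p ^ k.+1 * p ^ k.+1)); rewrite -divn_eq.
  by rewrite {1}(divn_eq a (p ^ k)) eA expnSr; ring.
rewrite eA eB; set x := a %/ _; set y := a %% _.
rewrite expnD !expnS; move: pk_gt0 pj_gt0; set P := p ^ k; set J := p ^ j.
move=> P0 J0; have : 0 < p * P * J by rewrite !muln_gt0 p_gt0 P0 J0.
case eN: (p * P * J) => [//|N] _ /=.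
have -> : p * (x + J * (t * P + y)) = p * x + t * (p * P * J) + p * J * y by ring.
by rewrite eN; ring.
Qed.

Lemma rot_digits_gt0 j a : j <= m -> 0 < a -> 0 < rot_digits j a.
Proof.
move=> le_jm; rewrite /rot_digits {1}(divn_eq a (p ^ (m - j))).
have p_gt0 : 0 < p by apply: ltnW.
have : 0 < p ^ j by rewrite expn_gt0 p_gt0.
by case: (a %/ _) => // ?; nia.
Qed.

Variables (U : finType) (n d : nat) (i : U -> nat) (w : U -> 'I_n -> nat).
Hypothesis i_lt : forall u, i u < p ^ m.
Hypothesis w_le : forall u, \sum_k w u k <= d.
Hypothesis dvd_total : (p ^ m).-1 %| \sum_u i u.
Hypothesis dvd_wsum : forall k, (p ^ m).-1 %| \sum_u i u * w u k.
Hypothesis total_gt0 : 0 < \sum_u i u.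

Let Q j := \sum_u rot_digits j (i u).
Let D l := \sum_u digit p (i u) l.

Lemma rot_sum_step j (v : U -> nat) : j < m ->
  p * (\sum_u rot_digits j (i u) * v u) = \sum_u rot_digits j.+1 (i u) * v u
     + (p ^ m).-1 * \sum_u digit p (i u) (m - j.+1) * v u.
Proof.
move=> lt_jm; rewrite !big_distrr -big_split /=; apply: eq_bigr => u _.
by rewrite mulnA rot_digitsS // mulnDl mulnA.
Qed.

Lemma dvd_rot_sum j (v : U -> nat) : j <= m ->
  (p ^ m).-1 %| \sum_u i u * v u ->
  (p ^ m).-1 %| \sum_u rot_digits j (i u) * v u.
Proof.
move=> + dv; elim: j => [|j IH] lt_jm.
  by under eq_bigr => u _ do rewrite rot_digits0 //.
have := dvdn_mull p (IH (ltnW lt_jm)).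
by rewrite rot_sum_step // dvdn_addl // dvdn_mulr.
Qed.

Lemma rot_sum_gt0 j (v : U -> nat) : j <= m ->
  0 < \sum_u i u * v u -> 0 < \sum_u rot_digits j (i u) * v u.
Proof.
move=> le_jm; rewrite !lt0n => /eqP nz; apply/eqP.
move/eqP; rewrite sum_nat_eq0 => /forallP z; apply: nz.
apply: big1 => u _; apply/eqP; move: (z u); rewrite /= !muln_eq0.
case/orP=> [|->]; last by rewrite orbT.
by apply: contraLR; rewrite negb_or -!lt0n => /andP[i0 _]; rewrite rot_digits_gt0.
Qed.

(* Together the alternatives mean rho <= max(1, ceil(r / d)), where r is the
   number of coordinates with positive sum. *)
Variable rho : nat.
Hypothesis rho_le :
  rho <= 1 \/ rho.-1 * d < #|[set k : 'I_n | 0 < \sum_u i u * w u k]|.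

Let q1_gt0 : 0 < (p ^ m).-1.
Proof. by have := ltn_expl m p_gt1; lia. Qed.

Let Q1 j : Q j = \sum_u rot_digits j (i u) * 1.
Proof. by apply: eq_bigr => u _; rewrite muln1. Qed.

Let dvdQ j : j <= m -> (p ^ m).-1 %| Q j.
Proof.
move=> le_jm; rewrite Q1; apply: dvd_rot_sum => //.
by under eq_bigr => u _ do rewrite muln1.
Qed.

Let R j := Q j %/ (p ^ m).-1.

(** Each of the coordinates with positive sum contributes a positive multiple
    of q - 1 to \sum_u rot(i u) |u|, which is at most d times the total. *)
Lemma rot_quotient_ge j : j <= m -> rho <= R j.
Proof.
move=> le_jm.
have R_gt0 : 0 < R j.
  rewrite divn_gt0 // dvdn_leq ?dvdQ // Q1 rot_sum_gt0 //.
  by under eq_bigr => u _ do rewrite muln1.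
case: rho_le => [le1|lt_r]; first exact: leq_trans le1 R_gt0.
suff : #|[set k : 'I_n | 0 < \sum_u i u * w u k]| <= R j * d.
  by move=> /(leq_trans lt_r); case: (rho) lt_r => // s _; rewrite ltn_mul2r => /andP[].
rewrite -(leq_pmul2r q1_gt0) mulnAC divnK ?dvdQ //.
rewrite -sum1_card big_distrl /=.
apply: (@leq_trans (\sum_k \sum_u rot_digits j (i u) * w u k)).
  rewrite [X in _ <= X](bigID (mem [set k : 'I_n | 0 < \sum_u i u * w u k])) /=.
  apply: leq_trans (leq_addr _ _); apply: leq_sum => k; rewrite inE => k_gt0.
  by rewrite mul1n dvdn_leq ?dvd_rot_sum ?rot_sum_gt0.
rewrite exchange_big big_distrl /=; apply: leq_sum => u _.
by rewrite -big_distrr /= leq_mul2l w_le orbT.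
Qed.

Let R_step j : j < m -> p * R j = R j.+1 + D (m - j.+1).
Proof.
move=> lt_jm; apply/eqP; rewrite -(eqn_pmul2r q1_gt0) -mulnA mulnDl.
rewrite !divnK ?dvdQ ?(ltnW lt_jm) // !Q1 rot_sum_step //.
rewrite [(p ^ m).-1 * _]mulnC; apply/eqP; congr (_ + _ * _).
by apply: eq_bigr => u _; rewrite muln1.
Qed.

Let R_full : R m = R 0.
Proof.
rewrite /R; congr (_ %/ _); apply: eq_bigr => u _.
by rewrite rot_digits_full rot_digits0.
Qed.

Let sumD : \sum_(u : U) digit_total p m (i u) = p.-1 * \sum_(j < m) R j.
Proof.
have e1 : \sum_(j < m) R j.+1 = \sum_(j < m) R j.
  have : \sum_(j < m.+1) R j = \sum_(j < m.+1) R j by [].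
  by rewrite {1}big_ord_recl big_ord_recr /= R_full addnC => /addIn.
have e2 : \sum_(j < m) D (m - j.+1) = \sum_(u : U) digit_total p m (i u).
  rewrite /digit_total [RHS]exchange_big /= [RHS](reindex_inj rev_ord_inj) /=.
  by apply: eq_bigr => j _; rewrite /D; apply: eq_bigr => u _; congr digit; lia.
apply: (@addnI (\sum_(j < m) R j)); rewrite -{1}e1 -e2 -big_split /=.
under eq_bigr => j _ do rewrite -R_step //.
by rewrite -big_distrr /= -mulSn prednK // ltnW.
Qed.

(** The conditions on i are inherited by all its digit shifts, whose totals
    are therefore R_j (q - 1) with R_j >= rho.  Summing the recurrence
    p R_j = R_(j+1) + (digit sum at one place) over a full cycle gives
    (p - 1) \sum_j R_j = total digit sum. *)
Lemma ax_bound : m * p.-1 * rho <= \sum_u digit_total p m (i u).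
Proof.
rewrite sumD -mulnA mulnCA leq_mul2l; apply/orP; right.
rewrite -[m in m * _]card_ord -sum_nat_const; apply: leq_sum => j _.
by rewrite rot_quotient_ge // ltnW.
Qed.

(** Equality forces R_j = rho for every j, and the recurrence then gives the
    digit sum at each place separately. *)
Lemma ax_bound_eq : \sum_u digit_total p m (i u) = m * p.-1 * rho ->
  forall l : 'I_m, \sum_u digit p (i u) l = p.-1 * rho.
Proof.
have p1_gt0 : 0 < p.-1 by lia.
rewrite sumD -mulnA mulnCA => /eqP; rewrite eqn_pmul2l //.
rewrite -[m in m * _]card_ord -sum_nat_const eq_sym => /eqP eqR.
have geR (j : 'I_m) : rho <= R j by rewrite rot_quotient_ge // ltnW.
have eR j : j < m -> R j = rho.
  move=> lt_jm; have := leqif_sum (fun (j : 'I_m) (_ : true) => leqif_eq (geR j)).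
  move=> [_]; rewrite eqR eqxx => /esym /forallP /(_ (Ordinal lt_jm)) /=.
  by move=> /eqP.
move=> l; have lt_lm := ltn_ord l.
have lt_jm : m - l.+1 < m by lia.
have := R_step lt_jm; rewrite (eR _ lt_jm).
have -> : R (m - l.+1).+1 = rho.
  case: (ltnP (m - l.+1).+1 m) => [/eR//|ge]; have -> : (m - l.+1).+1 = m by lia.
  by rewrite R_full eR.
have -> : m - (m - l.+1).+1 = l by lia.
rewrite -[\sum_u _]/(D l) => e; apply: (@addnI rho); rewrite -e.
by rewrite -mulSn prednK // ltnW.
Qed.

End AxBound.

(** * Power sums and the prime subfield *)

Section PowerSums.
Variables (F : finFieldType) (A : comNzRingType) (T : F -> A).
Hypotheses (T0 : T 0 = 0) (T1 : T 1 = 1) (TM : forall x y, T (x * y) = T x * T y).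
Hypothesis T_reg : forall z y, z != 1 -> (T z - 1) * y = 0 -> y = 0.

Lemma mult_lift_exp x k : T (x ^+ k) = T x ^+ k.
Proof. by elim: k => [|k IH]; rewrite ?expr0 // !exprS TM IH. Qed.

Lemma nonzero_expf_card1 (x : F) : x != 0 -> x ^+ #|F|.-1 = 1.
Proof.
move=> nz; apply: (mulfI nz); rewrite mulr1 -exprS prednK ?expf_card //.
exact: ltnW (finNzRing_gt1 F).
Qed.

Lemma exists_expf_neq1 e : ~~ (#|F|.-1 %| e)%N -> exists2 z : F, z != 0 & z ^+ e != 1.
Proof.
move=> ndvd; set q1 := #|F|.-1 in ndvd *.
have q1_gt0 : (0 < q1)%N by rewrite /q1 -subn1 subn_gt0 finNzRing_gt1.
have [/existsP[z /andP[]]|] := boolP [exists z : F, (z != 0) && (z ^+ e != 1)].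
  by exists z.
rewrite negb_exists => /forallP all1; case/negP: ndvd.
pose r := (e %% q1)%N; have lt_r : (r < q1)%N by rewrite ltn_mod.
rewrite /dvdn -/r; apply: contraTT isT => r_neq0.
have r_gt0 : (0 < r)%N by rewrite lt0n.
have p_neq0 : 'X^r - 1 != 0 :> {poly F} by rewrite -size_poly_gt0 size_XnsubC.
have := max_poly_roots p_neq0 (rs := enum (predC1 (0 : F))).
rewrite size_XnsubC // -cardE cardC1 -/q1 enum_uniq => lt.
suff /lt /(_ isT) : all (root ('X^r - 1)) (enum (predC1 (0 : F))) by rewrite ltnS leqNgt lt_r.
apply/allP => z; rewrite mem_enum inE => nz.
move: (all1 z); rewrite nz negbK /= => /eqP.
rewrite {1}(divn_eq e q1) exprD mulnC exprM nonzero_expf_card1 // expr1n mul1r => zr.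
by rewrite rootE !hornerE zr subrr.
Qed.

(** The substitution t := z t multiplies the sum by T(z)^e.  [T_reg] stands
    for the cancellation available in a domain, so that the lemma serves both
    for F itself and for Teichmueller lifts to a ring with nilpotents. *)
Lemma power_sum e : \sum_t T t ^+ e =
  if e == 0%N then #|F|%:R else if (#|F|.-1 %| e)%N then (#|F|.-1)%:R else 0.
Proof.
have [->|e_neq0] := eqVneq e 0%N.
  by rewrite (eq_bigr (fun=> 1)) // sumr_const.
have -> : \sum_t T t ^+ e = \sum_(t | t != 0) T t ^+ e.
  by rewrite (bigD1 0) //= T0 expr0n (negPf e_neq0) add0r.
case: ifPn => [/dvdnP[k ->]|ndvd].
  rewrite (eq_bigr (fun=> 1)) => [|t nz].
    by rewrite sumr_const cardC1.
  by rewrite -mult_lift_exp mulnC exprM nonzero_expf_card1 // expr1n.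
have [z nz ze] := exists_expf_neq1 ndvd.
apply: (T_reg ze); rewrite mulrBl mul1r.
rewrite [X in _ - X](reindex_inj (mulfI nz)) /=.
apply/eqP; rewrite subr_eq0; apply/eqP; rewrite big_distrr /=.
apply: eq_big => [t|t _]; first by rewrite mulf_eq0 negb_or nz.
by rewrite TM exprMn mult_lift_exp.
Qed.

End PowerSums.

Lemma power_sum_field (F : finFieldType) e : \sum_(t : F) t ^+ e =
  if (e == 0%N) || ~~ (#|F|.-1 %| e)%N then 0 else - 1.
Proof.
have q0 : #|F|%:R = 0 :> F.
  apply: (@addrI _ (\sum_(t : F) t)); rewrite addr0 [RHS](reindex_inj (addIr 1)) /=.
  by rewrite big_split /= sumr_const.
have -> : - 1 = (#|F|.-1)%:R :> F.
  have := finNzRing_gt1 F; case: #|F| q0 => // k; rewrite mulrSr => /eqP.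
  by rewrite addr_eq0 => /eqP->.
rewrite (@power_sum F F id) //; first by case: eqP => //= _; rewrite if_neg.
move=> z y z1 /eqP; rewrite mulf_eq0 subr_eq0 (negPf z1) => /eqP //.
Qed.

(** Both sides are ((1 + x)^n - 1) / x. *)
Lemma sum_geom_binomial (R : comNzRingType) (x : R) n : \sum_(i < n) (1 + x) ^+ i =
  \sum_(k < n) x ^+ k *+ 'C(n, k.+1).
Proof.
elim: n => [|n IH]; first by rewrite !big_ord0.
rewrite big_ord_recr /= IH [1 + x]addrC exprD1n.
have -> : \sum_(k < n) x ^+ k *+ 'C(n, k.+1) = \sum_(k < n.+1) x ^+ k *+ 'C(n, k.+1).
  by rewrite big_ord_recr /= bin_small // mulr0n addr0.
by rewrite -big_split /=; apply: eq_bigr => k _; rewrite -mulrnDr -binS.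
Qed.

Section PrimeSubfield.
Variables (p : nat) (F : finFieldType).
Hypotheses (p_prime : prime p) (charF : p \in [pchar F]).

Lemma natr_pchar_eqmod a b : a%:R = b%:R :> F -> a = b %[mod p].
Proof.
wlog le_ab : a b / (b <= a)%N.
  by move=> H; case/orP: (leq_total b a) => /H // + /esym => /[apply].
move/eqP; rewrite -subr_eq0 -natrB // -(dvdn_pcharf charF) => dv.
by apply/eqP; rewrite eqn_mod_dvd.
Qed.

(** 'X^p - 'X has at most p roots, and the natural numbers below p are p
    distinct ones. *)
Lemma prime_subfield (z : F) : z ^+ p = z -> exists n : 'I_p, z = n%:R.
Proof.
have p_gt1 := prime_gt1 p_prime.
move=> zp; have [/existsP[n /eqP ->]|] := boolP [exists n : 'I_p, z == n%:R].
  by exists n.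
rewrite negb_exists => /forallP nz.
have nat_inj : injective (fun n : 'I_p => n%:R : F).
  move=> i j; wlog le_ij : i j / (i <= j)%N.
    by move=> H; case/orP: (leq_total i j) => /H // + /esym => /[apply].
  move=> /esym /eqP; rewrite -subr_eq0 -natrB // -(dvdn_pcharf charF).
  have lt_jp := ltn_ord j; rewrite /dvdn modn_small; last by lia.
  by rewrite subn_eq0 => le_ji; apply/val_inj/eqP; rewrite eqn_leq le_ij.
have pol_neq0 : 'X^p - 'X != 0 :> {poly F}.
  by rewrite -size_poly_gt0 size_polyDl size_polyXn ?size_polyN ?size_polyX.
have := max_poly_roots pol_neq0 (rs := z :: [seq (n%:R : F) | n : 'I_p]).
rewrite size_polyDl size_polyXn ?size_polyN ?size_polyX //= size_map -cardE card_ord.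
rewrite ltnn => H; exfalso; suff: false by []; apply: H; last first.
  rewrite map_inj_uniq ?enum_uniq // andbT.
  by apply/mapP => -[n _ e]; case/negP: (nz n); apply/eqP.
rewrite rootE !hornerE zp subrr eqxx; apply/allP => _ /mapP[n _ ->].
by rewrite rootE !hornerE -[_ ^+ p](pFrobenius_autE charF) rmorph_nat subrr.
Qed.

End PrimeSubfield.

Section CyclotomicRing.
Variables (R : comNzRingType) (p : nat) (x : R).
Hypotheses (p_prime : prime p) (x_cyc : \sum_(i < p) (1 + x) ^+ i = 0).

(** p is the constant term of the cyclotomic relation expanded in x. *)
Lemma cyclotomic_dvd_p : exists w, p%:R = x * w.
Proof.
case: p p_prime x_cyc => // k _; rewrite sum_geom_binomial big_ord_recl.
rewrite expr0 bin1 => /eqP; rewrite addr_eq0 => /eqP e.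
exists (- \sum_(i < k) x ^+ i *+ 'C(k.+1, i.+2)).
rewrite e mulrN; congr (- _); rewrite big_distrr /=; apply: eq_bigr => i _.
by rewrite /bump /= add1n exprS mulrnAr.
Qed.

(** All coefficients of the relation but the leading one are divisible by p,
    so x^(p-1) is. *)
Lemma cyclotomic_nilpotent N : (p ^ N)%:R = 0 :> R -> x ^+ (p.-1 * N) = 0.
Proof.
move=> pN0; have [w ew] : exists w, x ^+ p.-1 = p%:R * w.
  have := sum_geom_binomial x p; rewrite x_cyc.
  case: p p_prime => // k pr; rewrite big_ord_recr /= binn mulr1n => /esym/eqP.
  rewrite addrC addr_eq0 => /eqP ->.
  exists (- \sum_(i < k) x ^+ i *+ ('C(k.+1, i.+1) %/ k.+1)).
  rewrite mulrN; congr (- _); rewrite big_distrr /=; apply: eq_bigr => i _.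
  have /divnK {1}<- : (k.+1 %| 'C(k.+1, i.+1))%N by rewrite prime_dvd_bin ?ltnS /= ?ltn_ord.
  by rewrite mulr_natl -mulrnA.
by rewrite exprM ew exprMn -natrX pN0 mul0r.
Qed.

End CyclotomicRing.

(** * Teichmueller lifts, Gauss sums and Stickelberger's congruence *)

(** O behaves like W(F)[zeta] modulo a power of p, where zeta is a primitive
    p-th root of unity and lam = zeta - 1: the residue map theta has kernel
    (lam), and lam is nilpotent, which makes O local. *)
Section RamifiedLift.
Variables (p m : nat) (F : finFieldType) (O : comNzRingType).
Variables (theta : {rmorphism O -> F}) (lam : O) (M : nat).
Hypotheses (p_prime : prime p) (m_gt0 : (0 < m)%N) (cardF : #|F| = (p ^ m)%N).
Hypothesis theta_surj : forall a, exists x, theta x = a.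
Hypothesis theta_ker : forall x, theta x = 0 -> exists y, x = lam * y.
Hypothesis lam_nilpotent : lam ^+ M = 0.
Hypothesis lam_cyclotomic : \sum_(i < p) (1 + lam) ^+ i = 0.

Let charF : p \in [pchar F]. Proof. exact: card_finPcharP cardF p_prime. Qed.
Let p_gt1 : (1 < p)%N. Proof. exact: prime_gt1. Qed.
Let p_gt0 : (0 < p)%N. Proof. exact: prime_gt0. Qed.

Lemma theta_lam : theta lam = 0.
Proof.
apply/eqP; have : theta lam ^+ M == 0 by rewrite -rmorphXn lam_nilpotent rmorph0.
by rewrite expf_eq0 => /andP[].
Qed.

Lemma one_plus_lam_unit w : exists2 y, (1 + lam * w) * y = 1 & theta y = 1.
Proof.
(* geometric series *)
exists (\sum_(i < M) (- (lam * w)) ^+ i).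
  have := subrX1 (- (lam * w)) M.
  rewrite exprNn exprMn lam_nilpotent mul0r mulr0 sub0r => /eqP.
  by rewrite eqr_oppLR -mulNr opprB opprK => /eqP.
case: M lam_nilpotent => [/eqP|k _]; first by rewrite expr0 oner_eq0.
rewrite big_ord_recl expr0 rmorphD rmorph1 rmorph_sum big1 ?addr0 // => i _.
by rewrite rmorphXn rmorphN rmorphM theta_lam mul0r oppr0 exprS mul0r.
Qed.

Lemma theta_unit x : theta x != 0 -> exists y, x * y = 1.
Proof.
move=> nz; have [y0 ey] := theta_surj (theta x)^-1.
have [|z ez] := @theta_ker (x * y0 - 1).
  by rewrite rmorphB rmorphM ey mulfV // rmorph1 subrr.
have [u eu _] := one_plus_lam_unit z.
by exists (y0 * u); rewrite mulrA -(subrK 1 (x * y0)) ez addrC.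
Qed.

(** Elements with nonzero residue can be cancelled; this replaces the
    integrality of O. *)
Lemma theta_reg x y : theta x != 0 -> x * y = 0 -> y = 0.
Proof.
by case/theta_unit => z xz xy; rewrite -[y]mul1r -xz mulrAC xy mul0r.
Qed.

Lemma one_plus_lam_expp : (1 + lam) ^+ p = 1.
Proof. by apply/eqP; rewrite -subr_eq0 subrX1 lam_cyclotomic mulr0. Qed.

(** In the expansion of the cyclotomic relation the inner binomial coefficients
    are divisible by p, hence p (1 + lam w) = - lam^(p-1). *)
Lemma p_ramified : exists2 kap, p%:R = lam ^+ p.-1 * kap & theta kap = - 1.
Proof.
have := sum_geom_binomial lam p; rewrite lam_cyclotomic.
have -> : \sum_(k < p) lam ^+ k *+ 'C(p, k.+1)
   = p%:R * (1 + lam * (\sum_(k < p.-2) lam ^+ k * ('C(p, k.+2) %/ p)%:R)) + lam ^+ p.-1.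
  case: p p_prime => [|[|n]] // pr; rewrite big_ord_recl big_ord_recr /= bin1 binn.
  rewrite expr0 mulr1n mulrDr mulr1 addrA; congr (_ + _ + _).
  rewrite !big_distrr /=; apply: eq_bigr => k _; rewrite /bump /= !add1n.
  have /divnK {1}<- : (n.+2 %| 'C(n.+2, k.+2))%N by rewrite prime_dvd_bin ?ltnS /=.
  by rewrite -mulr_natr natrM exprS; ring.
set w := \sum_(k < _) _ => /esym /eqP; rewrite addr_eq0 => /eqP e.
have [y ey ty] := one_plus_lam_unit w.
exists (- y); last by rewrite rmorphN ty.
by rewrite mulrN -mulNr -e -mulrA ey mulr1.
Qed.

Lemma q_ramified : exists2 kap, (p ^ m)%:R = lam ^+ (m * p.-1) * kap & theta kap = (- 1) ^+ m.
Proof.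
have [kap e t] := p_ramified; exists (kap ^+ m); last by rewrite rmorphXn t.
by rewrite natrX e exprMn -exprM mulnC.
Qed.

Section Descent.
Variable N : nat.
Hypothesis natO : forall k, k%:R = 0 :> O -> (p ^ N %| k)%N.

(** If x were a unit then lam^((p-1) v) = 0, so p^v = 0 in O, although v < N. *)
Lemma lam_exp_reg v x : (v < N)%N -> lam ^+ (p.-1 * v) * x = 0 -> theta x = 0.
Proof.
move=> lt_vN; rewrite mulrC => e; apply/eqP; apply: contraT => nz.
have [kap ek _] := p_ramified; have := theta_reg nz e => lam0.
have /natO : (p ^ v)%:R = 0 :> O by rewrite natrX ek exprMn -exprM lam0 mul0r.
by rewrite dvdn_Pexp2l // leqNgt lt_vN.
Qed.

(** A natural number divisible by lam^((p-1) K) is divisible by p^K: powers of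
    p are extracted one at a time, since a cofactor prime to p is a unit.  The
    residue of the last cofactor is that of y, up to the sign of
    p = - lam^(p-1). *)
Lemma natr_lam_descent a K y : (K < N)%N -> a%:R = lam ^+ (p.-1 * K) * y ->
  exists2 b, a = (p ^ K * b)%N & (- 1) ^+ K * b%:R = theta y.
Proof.
move=> lt_KN ea; have [kap ek tk] := p_ramified.
have reg v b : (v <= K)%N -> a = (p ^ v * b)%N ->
    (- 1) ^+ v * b%:R = theta (lam ^+ (p.-1 * (K - v)) * y).
  move=> le_vK eb; apply/eqP; rewrite -subr_eq0 -tk -rmorphXn -[b%:R](rmorph_nat theta).
  rewrite -rmorphM -rmorphB; apply/eqP/(@lam_exp_reg v); first exact: leq_ltn_trans lt_KN.
  rewrite mulrBr mulrA [X in _ - X]mulrA -exprD -mulnDr subnKC // -ea eb natrM natrX ek.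
  by rewrite exprMn -exprM subrr.
have dvd v : (v <= K)%N -> (p ^ v %| a)%N.
  elim: v => [|v IH] lt_vK; first by rewrite dvd1n.
  have /dvdnP[b eb] := IH (ltnW lt_vK); rewrite mulnC in eb.
  have := reg v b (ltnW lt_vK) eb.
  rewrite rmorphM rmorphXn theta_lam expr0n muln_eq0 subn_eq0 leqNgt lt_vK orbF.
  have -> : (p.-1 == 0)%N = false by move: p_gt1; case: (p) => [|[]].
  rewrite mul0r => /eqP; rewrite mulf_eq0 signr_eq0 /= -(dvdn_pcharf charF).
  by rewrite eb expnSr => dv; rewrite dvdn_mul.
have /dvdnP[b eb] := dvd K (leqnn K); rewrite mulnC in eb.
by exists b; rewrite // (reg K b) // subnn muln0 expr0 mul1r.
Qed.

End Descent.

(** p-th powers turn congruences modulo lam^k into congruences modulo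
    lam^(k+1), as p itself is a multiple of lam. *)
Lemma expp_congr k x z : (0 < k)%N ->
  exists z', (x + lam ^+ k * z) ^+ p = x ^+ p + lam ^+ k.+1 * z'.
Proof.
move=> k_gt0; rewrite exprDn big_ord_recl /= subn0 expr0 mulr1 bin0 mulr1n.
have [w ew] := cyclotomic_dvd_p p_prime lam_cyclotomic.
have /fin_all_exists[f ef] (i : 'I_p) : exists y,
    x ^+ (p - lift ord0 i) * (lam ^+ k * z) ^+ lift ord0 i *+ 'C(p, lift ord0 i)
      = lam ^+ k.+1 * y.
  rewrite /= /bump /= add1n.
  have [lt_ip|ge_ip] := ltnP i.+1 p.
    exists (x ^+ (p - i.+1) * (z * (lam ^+ k * z) ^+ i) * w * ('C(p, i.+1) %/ p)%:R).
    have /divnK eC : (p %| 'C(p, i.+1))%N by rewrite prime_dvd_bin.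
    by rewrite -mulr_natr -{1}eC natrM ew !exprS; ring.
  have -> : i.+1 = p by apply/eqP; rewrite eqn_leq ge_ip ltn_ord.
  exists (lam ^+ (k * p - k.+1) * z ^+ p).
  rewrite subnn expr0 mul1r binn mulr1n exprMn -exprM mulrA -exprD subnKC //.
  by move: p_gt1; nia.
exists (\sum_i f i); rewrite big_distrr /=; congr (_ + _); apply: eq_bigr => i _.
exact: ef.
Qed.

Lemma theta_expq x y : theta x = theta y -> x ^+ (#|F| ^ M) = y ^+ (#|F| ^ M).
Proof.
move=> exy; have [|z ez] := @theta_ker (x - y); first by rewrite rmorphB exy subrr.
have main k : exists z', x ^+ (p ^ k) = y ^+ (p ^ k) + lam ^+ k.+1 * z'.
  elim: k => [|k [z' IH]].
    by exists z; rewrite !expr1 -ez addrC subrK.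
  have [z'' e] := @expp_congr k.+1 (y ^+ (p ^ k)) z' isT.
  by exists z''; rewrite expnSr !exprM IH e.
rewrite cardF -expnM; have [z' ->] := main (m * M)%N.
have -> : (m * M).+1 = (M + (m.-1 * M).+1)%N by nia.
by rewrite exprD lam_nilpotent !mul0r addr0.
Qed.

Lemma expf_card_iter (a : F) k : a ^+ (#|F| ^ k) = a.
Proof. by elim: k => [|k IH]; rewrite ?expr1 // expnSr exprM IH expf_card. Qed.

(** All lifts of x to O have the same q^M-th power, so that this power depends
    multiplicatively on x. *)
Lemma teichmuller : exists T : F -> O,
  [/\ T 0 = 0, T 1 = 1, forall x y, T (x * y) = T x * T y & forall x, theta (T x) = x].
Proof.
have /fin_all_exists[L eL] := theta_surj.
exists (fun x => L x ^+ (#|F| ^ M)); split.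
- rewrite (@theta_expq _ 0) ?eL ?rmorph0 // expr0n.
  by rewrite expn_eq0 cardF expn_eq0 eqn0Ngt p_gt0.
- by rewrite (@theta_expq _ 1) ?eL ?rmorph1 // expr1n.
- by move=> x y; rewrite -exprMn; apply: theta_expq; rewrite rmorphM !eL.
- by move=> x; rewrite rmorphXn eL expf_card_iter.
Qed.

Definition abs_trace (y : F) : F := \sum_(j < m) y ^+ (p ^ j).

Lemma abs_traceD x y : abs_trace (x + y) = abs_trace x + abs_trace y.
Proof.
rewrite /abs_trace -big_split /=; apply: eq_bigr => j _.
by rewrite exprDn_pchar // pnatX (pnatE _ p_prime) charF.
Qed.

Lemma abs_trace_nat x : exists n : 'I_p, abs_trace x = n%:R.
Proof.
apply: (prime_subfield p_prime charF); rewrite -(pFrobenius_autE charF) rmorph_sum /=.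
have -> : \sum_(j < m) pFrobenius_aut charF (x ^+ (p ^ j)) = \sum_(j < m) x ^+ (p ^ j.+1).
  by apply: eq_bigr => j _; rewrite pFrobenius_autE -exprM expnSr.
apply: (@addrI _ x); rewrite [RHS]addrC /abs_trace.
have : \sum_(j < m.+1) x ^+ (p ^ j) = \sum_(j < m.+1) x ^+ (p ^ j) by [].
rewrite {1}big_ord_recl big_ord_recr /= expr1 -cardF expf_card => <-.
by congr (_ + _); apply: eq_bigr.
Qed.

Variable T : F -> O.
Hypotheses (T0 : T 0 = 0) (T1 : T 1 = 1) (TM : forall x y, T (x * y) = T x * T y).
Hypothesis theta_T : forall x, theta (T x) = x.

Lemma T_sub1_reg z y : z != 1 -> (T z - 1) * y = 0 -> y = 0.
Proof.
by move=> z1; apply: theta_reg; rewrite rmorphB rmorph1 theta_T subr_eq0.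
Qed.

Let Q := #|F|.-1.

Let cardFS : #|F| = Q.+1.
Proof. by rewrite /Q prednK // ltnW ?finNzRing_gt1. Qed.

Let Q_gt0 : (0 < Q)%N.
Proof. by rewrite -ltnS -cardFS finNzRing_gt1. Qed.

Let pmQ : (p ^ m)%N = Q.+1. Proof. by rewrite -cardF. Qed.

Lemma T_sum e : \sum_t T t ^+ e =
  if e == 0%N then #|F|%:R else if (#|F|.-1 %| e)%N then (#|F|.-1)%:R else 0.
Proof. exact: (power_sum T0 T1 TM T_sub1_reg). Qed.

Lemma T_expQ x : x != 0 -> T x ^+ Q = 1.
Proof. by move=> nz; rewrite -(mult_lift_exp T1 TM) nonzero_expf_card1. Qed.

Lemma theta_Q : theta Q%:R = - 1.
Proof.
rewrite rmorph_nat; apply/eqP; rewrite -addr_eq0 natr1 -pmQ.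
by rewrite -(dvdn_pcharf charF) -(prednK m_gt0) expnS dvdn_mulr.
Qed.

Lemma natF_small_neq0 k : (0 < k < p)%N -> k%:R != 0 :> F.
Proof.
case/andP => k0 kp; rewrite -(dvdn_pcharf charF).
by apply/negP => /(dvdn_leq k0); rewrite leqNgt kp.
Qed.

Lemma expX_le_Q l : (l < m)%N -> (p ^ l <= Q)%N.
Proof. by move=> lt_lm; rewrite -ltnS -pmQ ltn_exp2l. Qed.

(** Of the monomials t^(Q - p^l + p^j) only the one with j = l has an exponent
    divisible by Q = q - 1. *)
Lemma power_sum_trace l : (l < m)%N -> \sum_t t ^+ (Q - p ^ l) * abs_trace t = - 1.
Proof.
move=> lt_lm; have le_lQ := expX_le_Q lt_lm.
under eq_bigr => t _ do rewrite /abs_trace big_distrr /=.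
rewrite exchange_big /= (bigD1 (Ordinal lt_lm)) //= [X in _ + X]big1 => [|j neq_jl].
  rewrite addr0.
  under eq_bigr => t _ do rewrite -exprD subnK //.
  by rewrite power_sum_field dvdnn -/Q orbF -[_ == _]negbK -lt0n Q_gt0.
under eq_bigr => t _ do rewrite -exprD.
rewrite power_sum_field -/Q; case: ifPn => //; rewrite negb_or negbK => /andP[_].
have le_jQ := expX_le_Q (ltn_ord j); have pj0 : (0 < p ^ j)%N by rewrite expn_gt0 p_gt0.
have pl0 : (0 < p ^ l)%N by rewrite expn_gt0 p_gt0.
case/dvdnP => k ek; case/negP: neq_jl; rewrite -val_eqE /=.
rewrite -(eqn_exp2l _ _ p_gt1); apply/eqP.
have : (0 < k < 2)%N by apply/andP; split; nia.
by case: k ek => [|[|k]] // + _; lia.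
Qed.

Lemma exists_abs_trace1 : exists y, abs_trace y = 1.
Proof.
have [y nz] : exists y, abs_trace y != 0.
  apply/existsP; apply: contraT; rewrite negb_exists => /forallP z.
  have := power_sum_trace m_gt0; rewrite big1 => [/esym/eqP|t _].
    by rewrite oppr_eq0 oner_eq0.
  by move: (z t); rewrite negbK => /eqP->; rewrite mulr0.
(* The trace lies in the prime field, over which it is linear. *)
have [c ec] := abs_trace_nat y.
have fixc k : (abs_trace y)^-1 ^+ (p ^ k) = (abs_trace y)^-1.
  elim: k => [|k IH]; first by rewrite expn0 expr1.
  by rewrite expnSr exprM IH exprVn ec -(pFrobenius_autE charF) pFrobenius_aut_nat.
exists ((abs_trace y)^-1 * y); move: (mulVf nz) fixc; move: (abs_trace y)^-1 => z <- fixc.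
rewrite /abs_trace big_distrr /=; apply: eq_bigr => j _.
by rewrite exprMn fixc.
Qed.

Variable tr : F -> 'I_p.
Hypothesis trE : forall x, abs_trace x = (tr x)%:R.

Definition add_char (y : F) : O := (1 + lam) ^+ tr y.

Lemma add_char_eqmod a b : a%:R = b%:R :> F -> (1 + lam) ^+ a = (1 + lam) ^+ b.
Proof.
move/(natr_pchar_eqmod charF) => e.
by rewrite -(expr_mod a one_plus_lam_expp) e expr_mod // one_plus_lam_expp.
Qed.

Lemma add_charD x y : add_char (x + y) = add_char x * add_char y.
Proof.
rewrite /add_char -exprD; apply: add_char_eqmod.
by rewrite natrD -!trE abs_traceD.
Qed.

Lemma add_char0 : add_char 0 = 1.
Proof.
rewrite /add_char -(expr0 (1 + lam)); apply: add_char_eqmod.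
rewrite -trE /abs_trace big1 // => j _.
by rewrite expr0n expn_eq0 eqn0Ngt p_gt0.
Qed.

Lemma add_char_sum_family (I : finType) (g : I -> F) :
  add_char (\sum_u g u) = \prod_u add_char (g u).
Proof. exact: (big_morph _ add_charD add_char0). Qed.

Lemma one_plus_lam_exp n :
  exists2 z, (1 + lam) ^+ n = 1 + lam * z & theta z = n%:R.
Proof.
elim: n => [|n [z IH tz]]; first by exists 0; rewrite ?rmorph0 ?mulr0 ?addr0.
exists (z + 1 + lam * z); first by rewrite exprS IH; ring.
by rewrite !rmorphD rmorphM theta_lam rmorph1 mul0r addr0 tz natr1.
Qed.

(** All fibres of the trace have the same size, as translation by an element of
    trace 1 permutes them, and the p-th roots of unity zeta^c sum to 0.  The
    usual argument, (psi(y) - 1) \sum psi = 0, only bounds the sum up to a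
    multiple of a zero divisor. *)
Lemma sum_add_char : \sum_t add_char t = 0.
Proof.
have [y0 ey0] := exists_abs_trace1.
rewrite (partition_big tr xpredT) //=.
have fiber (c : 'I_p) : \sum_(t | tr t == c) add_char t
    = (1 + lam) ^+ c * #|[pred t | abs_trace t == 0]|%:R.
  rewrite (eq_bigr (fun=> (1 + lam) ^+ c)) => [|t /eqP<- //].
  rewrite sumr_const -[LHS]mulr_natr; congr (_ * _%:R).
  rewrite -[RHS](card_imset _ (addIr (c%:R * y0))); apply/esym/eq_card => t.
  have traceMn k y : abs_trace (k%:R * y) = k%:R * abs_trace y.
    elim: k => [|k IH].
      rewrite !mul0r /abs_trace big1 // => j _.
      by rewrite expr0n expn_eq0 eqn0Ngt p_gt0.
    by rewrite mulrS !mulrDl !mul1r abs_traceD IH.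
  rewrite [RHS]inE /=; apply/imsetP/eqnP => [[s]|<-].
    rewrite inE => /eqP ts ->.
    rewrite -[val _](modn_small (ltn_ord _)) -[RHS]/(val c) -[RHS](modn_small (ltn_ord c)).
    by apply: (natr_pchar_eqmod charF); rewrite -trE abs_traceD traceMn ey0 ts mulr1 add0r.
  exists (t - (tr t)%:R * y0); last by rewrite subrK.
  apply/eqP; apply: (@addIr _ (abs_trace ((tr t)%:R * y0))).
  by rewrite -abs_traceD subrK traceMn ey0 mulr1 add0r trE.
under eq_bigr => c _ do rewrite fiber.
by rewrite -big_distrl /= lam_cyclotomic mul0r.
Qed.

Lemma sum_add_charM y :
  \sum_t add_char (t * y) = if y == 0 then (p ^ m)%:R else 0.
Proof.
case: eqP => [->|/eqP nz].
  rewrite (eq_bigr (fun=> 1)) => [|t _]; last by rewrite mulr0 add_char0.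
  by rewrite sumr_const cardF.
by rewrite -[RHS]sum_add_char [RHS](reindex_inj (mulIf nz)).
Qed.

(** The Gauss sum of the character T^-a, extended by 0 at 0; the exponent is
    written as Q - a because T 0 has no inverse. *)
Definition gauss_sum a := \sum_t T t ^+ (Q - a) * add_char t.

Lemma gauss_sum0 : gauss_sum 0 = - 1.
Proof.
rewrite /gauss_sum subn0 (bigD1 0) //= T0 expr0n eqn0Ngt Q_gt0 mul0r add0r.
rewrite (eq_bigr add_char) => [|t nz]; last by rewrite T_expQ ?mul1r.
have := sum_add_char; rewrite (bigD1 0) //= add_char0 => e.
by apply: (@addrI _ 1); rewrite e subrr.
Qed.

Definition jacobi_sum a b := \sum_s T s ^+ (Q - a) * T (1 - s) ^+ (Q - b).

(** In the double sum over s and t, the terms with s + t = r contribute the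
    Jacobi sum times T(r)^-(a+b) psi(r), by the substitution s := r s.  For
    r = 0 they cancel because Q does not divide a + b. *)
Lemma jacobi_sumE a b : (0 < a + b < Q)%N ->
  gauss_sum a * gauss_sum b = jacobi_sum a b * gauss_sum (a + b).
Proof.
case/andP => ab_gt0 ab_lt; rewrite /gauss_sum big_distrlr /=.
transitivity (\sum_r (\sum_s T s ^+ (Q - a) * T (r - s) ^+ (Q - b)) * add_char r).
  under [RHS]eq_bigr => r _ do rewrite big_distrl /=.
  rewrite [RHS]exchange_big /=; apply: eq_bigr => s _.
  rewrite [RHS](reindex_inj (addIr s)) /=; apply: eq_bigr => t _.
  by rewrite addrK [t + s]addrC add_charD mulrACA.
rewrite [RHS]big_distrr /=; apply: eq_bigr => r _; rewrite mulrA; congr (_ * _).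
have [->|nz] := eqVneq r 0.
  rewrite T0 [in RHS]expr0n subn_eq0 leqNgt ab_lt mulr0.
  transitivity (T (-1) ^+ (Q - b) * \sum_s T s ^+ (Q - a + (Q - b))).
    rewrite big_distrr /=; apply: eq_bigr => s _.
    by rewrite sub0r -[- s]mulN1r TM exprMn exprD mulrCA.
  rewrite T_sum -/Q; case: eqP => [|_]; first by lia.
  case: ifPn => [/dvdnP[k ek]|_]; last by rewrite mulr0.
  have : (1 < k < 2)%N by apply/andP; split; nia.
  by lia.
rewrite (reindex_inj (mulfI nz)) /= [RHS]mulrC big_distrr /=; apply: eq_bigr => s _.
rewrite -{2}[r]mulr1 -mulrBr !TM !exprMn.
have -> : T r ^+ (Q - (a + b)) = T r ^+ (Q - a) * T r ^+ (Q - b).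
  rewrite -exprD; have -> : (Q - a + (Q - b) = (Q - (a + b)) + Q)%N by lia.
  by rewrite exprD T_expQ ?mulr1.
by ring.
Qed.

Lemma power_sum_horner (P : {poly F}) r : (r < Q)%N -> (size P <= Q)%N ->
  \sum_s s ^+ (Q - r) * P.[s] = - P`_r.
Proof.
move=> lt_rQ le_PQ.
under eq_bigr => s _ do rewrite (horner_coef_wide _ le_PQ) big_distrr /=.
rewrite exchange_big /= (bigD1 (Ordinal lt_rQ)) //= [X in _ + X]big1 => [|k nk].
  rewrite addr0.
  under eq_bigr => s _ do rewrite mulrCA -exprD subnK ?(ltnW lt_rQ) //.
  rewrite -big_distrr /= power_sum_field dvdnn -/Q orbF -[_ == _]negbK -lt0n Q_gt0.
  by rewrite mulrN1.
under eq_bigr => s _ do rewrite mulrCA -exprD.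
rewrite -big_distrr /= power_sum_field -/Q; case: ifPn; rewrite ?mulr0 //.
rewrite negb_or negbK => /andP[_ /dvdnP[t et]]; have lt_kQ := ltn_ord k.
case/negP: nk; rewrite -val_eqE /=; apply/eqP.
have : (0 < t < 2)%N by apply/andP; split; nia.
by case: t et => [|[|t]] // + _; lia.
Qed.

(** In characteristic p, (1 - s)^(Q - a) = (1 - s)^B (1 - s^(p^l))^A where A and
    B are the quotient and the remainder of Q - a by p^l.  Its coefficient at
    s^(p^l) is - A, and the last digit of A is p - 1 minus the l-th digit
    of a. *)
Lemma theta_jacobi_sum a l : (l < m)%N -> (p ^ l < Q)%N -> (0 < a)%N -> (a < Q)%N ->
  theta (jacobi_sum (p ^ l) a) = - (digit p a l).+1%:R.
Proof.
move=> lt_lm lt_lQ a_gt0 lt_aQ; set r := (p ^ l)%N in lt_lQ *.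
have r_gt0 : (0 < r)%N by rewrite expn_gt0 p_gt0.
pose A := ((Q - a) %/ r)%N; pose B := ((Q - a) %% r)%N.
pose P : {poly F} := (1 - 'X) ^+ B * (1 - 'X^r) ^+ A.
have frob (x : {poly F}) : (1 - x) ^+ r = 1 - x ^+ r.
  have chP : [pchar {poly F}].-nat r.
    by rewrite /r pnatX (pnatE _ p_prime) (rmorph_pchar polyC charF).
  by apply: (@addIr _ (x ^+ r)); rewrite -exprDn_pchar // !subrK expr1n.
have PE : P = (1 - 'X) ^+ (Q - a).
  by rewrite (divn_eq (Q - a) r) mulnC exprD exprM frob /P mulrC.
have sizeP : (size P <= Q)%N.
  rewrite PE; apply: leq_trans (size_poly_exp_leq _ _) _.
  have -> : size (1 - 'X : {poly F}) = 2 by rewrite -opprB size_polyN size_XsubC.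
  by rewrite mul1n; lia.
rewrite rmorph_sum (eq_bigr (fun s => s ^+ (Q - r) * P.[s])); last first.
  by move=> s _; rewrite rmorphM !rmorphXn !theta_T PE !hornerE.
rewrite power_sum_horner //; congr (- _).
have [W eW] : exists W : {poly F},
    (1 - 'X^r) ^+ A = 1 - A%:R * 'X^r + 'X^(r.+1) * W :> {poly F}.
  elim: (A) => [|k [W IH]]; first by exists 0; rewrite mul0r subr0 mulr0 addr0.
  exists ((1 - 'X^r) * W + k%:R * 'X^(r.-1)).
  have eXX : 'X^r * 'X^r = 'X^(r.+1) * 'X^(r.-1) :> {poly F}.
    by rewrite -!exprD; congr (_ ^+ _); lia.
  rewrite exprS IH mulrDr mulrBl mul1r mulrBr mulr1 mulrCA eXX mulrS; ring.
have small : (size ((1 - 'X) ^+ B : {poly F}) <= r)%N.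
  apply: leq_trans (size_poly_exp_leq _ _) _.
  have -> : size (1 - 'X : {poly F}) = 2 by rewrite -opprB size_polyN size_XsubC.
  by rewrite mul1n ltn_mod.
have coefB0 : ((1 - 'X) ^+ B : {poly F})`_0 = 1.
  by rewrite -horner_coef0 !hornerE subr0 expr1n.
have -> : P = (1 - 'X) ^+ B - (A%:R)%:P * ('X^r * (1 - 'X) ^+ B)
              + 'X^(r.+1) * ((1 - 'X) ^+ B * W).
  by rewrite /P eW polyC_natr; ring.
rewrite coefD coefB coefCM !coefXnM ltnn ltnSn subnn addr0 coefB0 mulr1.
rewrite nth_default // sub0r; apply/eqP; rewrite eqr_oppLR -addr_eq0 -natrD.
have lt_h : (a %/ r < p ^ (m - l))%N.
  by rewrite ltn_divLR // -expnD subnK ?(ltnW lt_lm) // pmQ ltnS ltnW.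
have eA : (A + (a %/ r).+1 = p ^ (m - l))%N.
  have eQ : (Q - a = (p ^ (m - l) - (a %/ r).+1) * r + (r.-1 - a %% r))%N.
    have : (p ^ (m - l) * r)%N = Q.+1 by rewrite -expnD subnK ?(ltnW lt_lm).
    have := divn_eq a r; have := ltn_pmod a r_gt0.
    move: (a %/ r)%N (a %% r)%N (p ^ (m - l))%N lt_h => h s N lt_hN lt_s ea eN.
    have [N' eN'] : exists N', (N = N' + h.+1)%N by exists (N - h.+1)%N; lia.
    by rewrite eN' addnK; nia.
  rewrite /A eQ divnMDl // [X in (_ + X + _)%N]divn_small ?addn0 ?subnK //.
  by rewrite (leq_ltn_trans (leq_subr _ _)) // ltn_predL.
have -> : (A + (digit p a l).+1)%N%:R = (A + (a %/ r).+1)%N%:R :> F.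
  by rewrite !natrD -!natr1 /digit -(GRing.natr_mod_pchar charF (a %/ r)%N).
by rewrite eA -(dvdn_pcharf charF) dvdn_exp // subn_gt0.
Qed.

(** psi = 1 + lam Tr modulo lam^2; the constant 1 contributes nothing. *)
Lemma gauss_sum_base l : (l < m)%N -> (p ^ l < Q)%N ->
  exists2 c, gauss_sum (p ^ l) = lam * c & theta c = - 1.
Proof.
move=> lt_lm lt_lQ.
have /fin_all_exists2[z ez tz] (t : F) := one_plus_lam_exp (tr t).
exists (\sum_t T t ^+ (Q - p ^ l) * z t).
  rewrite /gauss_sum (eq_bigr (fun t => T t ^+ (Q - p ^ l)
    + lam * (T t ^+ (Q - p ^ l) * z t))) => [|t _]; last first.
    by rewrite /add_char ez mulrDr mulr1 mulrCA.
  rewrite big_split /= -big_distrr /= T_sum -/Q subn_eq0 leqNgt lt_lQ /=.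
  case: ifPn => [/dvdnP[k ek]|_]; last by rewrite add0r.
  have pl0 : (0 < p ^ l)%N by rewrite expn_gt0 p_gt0.
  by case: k ek => [|k]; nia.
rewrite rmorph_sum -(power_sum_trace lt_lm); apply: eq_bigr => t _.
by rewrite rmorphM rmorphXn theta_T tz trE.
Qed.

(** Stickelberger's congruence.  When p^l is added to b without carry, the
    Jacobi sum relating the three Gauss sums has as residue minus the new
    digit, and the new digit is the factor by which gam grows. *)
Lemma gauss_sum_stickelberger a : (a < Q)%N -> exists2 c,
  gauss_sum a = lam ^+ digit_total p m a * c & theta c = - (gam p m a)%:R^-1.
Proof.
elim/ltn_ind: a => a IH lt_aQ.
have [->|a_gt0] := posnP a.
  exists (- 1); last by rewrite gam0 invr1 rmorphN1.
  by rewrite gauss_sum0 digit_total0 expr0 mul1r.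
have [|b [l [lt_lm ea lt_d]]] := @sub_digit p p_gt1 m a.
  by rewrite a_gt0 pmQ ltnS ltnW.
have pl_gt0 : (0 < p ^ l)%N by rewrite expn_gt0 p_gt0.
have [lt_lQ lt_ba] : (p ^ l < Q)%N /\ (b < a)%N by split; lia.
have [cl el tl] := gauss_sum_base lt_lm lt_lQ.
rewrite ea digit_total_addX // gam_addX //.
have [b0|b_gt0] := posnP b.
  exists cl; last by rewrite tl b0 gam0 digit0 invr1.
  by rewrite b0 add0n el digit_total0 expr1.
have [cb eb tb] := IH b lt_ba (ltn_trans lt_ba lt_aQ).
have tj := theta_jacobi_sum lt_lm lt_lQ b_gt0 (ltn_trans lt_ba lt_aQ).
have [|y ey] := @theta_unit (jacobi_sum (p ^ l) b).
  by rewrite tj oppr_eq0 natF_small_neq0.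
exists (cb * cl * y).
  have := @jacobi_sumE (p ^ l) b; rewrite [(p ^ l + b)%N]addnC -ea a_gt0 => /(_ lt_aQ).
  rewrite eb el => e; rewrite -[LHS]mul1r -ey mulrAC -e exprSr; ring.
have ty : theta y = - (digit p b l).+1%:R^-1.
  have : theta (jacobi_sum (p ^ l) b * y) = 1 by rewrite ey rmorph1.
  rewrite rmorphM tj => e; rewrite -invrN; apply: (mulfI (x := - (digit p b l).+1%:R)).
    by rewrite oppr_eq0 natF_small_neq0.
  by rewrite e mulfV // oppr_eq0 natF_small_neq0.
by rewrite !(rmorphM theta) tb tl ty natrM invfM; ring.
Qed.

(** Fourier inversion on F^*, corrected so as to hold at 0 as well: T^0 and T^Q
    agree on F^*, and the value 1 at 0 fixes the coefficient of T^0 to be 1,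
    leaving - q / (q - 1) for that of T^Q. *)
Lemma add_char_expansion : exists c : nat -> O,
  (forall j, (j < p ^ m)%N -> theta (c j) = (gam p m j)%:R^-1) /\
  forall y, add_char y =
    \sum_(j < p ^ m) lam ^+ digit_total p m j * c j * T y ^+ j.
Proof.
have [|v ev] := @theta_unit Q%:R; first by rewrite theta_Q oppr_eq0 oner_eq0.
have tv : theta v = - 1.
  have : theta (Q%:R * v) = 1 by rewrite ev rmorph1.
  by rewrite rmorphM theta_Q mulN1r => /eqP; rewrite eqr_oppLR => /eqP.
have /fin_all_exists2[g eg tg] (j : 'I_Q) := gauss_sum_stickelberger (ltn_ord j).
have [kap ek tk] := q_ramified.
(* v is the inverse of q - 1; the last branch is reached only for j = Q. *)
pose c j := if j == 0%N then 1 else if insub j is Some i then v * g i else - v * kap.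
have cE (j : 'I_Q) : (0 < j)%N ->
    lam ^+ digit_total p m j * c j = v * gauss_sum j.
  by move=> j_gt0; rewrite /c gtn_eqF // valK eg mulrCA.
have cQ : lam ^+ digit_total p m Q * c Q = - v * Q.+1%:R.
  rewrite /c gtn_eqF // insubF ?ltnn //.
  by rewrite -[in digit_total _ _ _]/(Q.+1.-1) -pmQ digit_total_predX // ek mulrCA.
have c0 : c 0%N = 1 by rewrite /c eqxx.
exists c; split=> [j|y].
  rewrite pmQ ltnS => le_jQ; rewrite /c.
  case: eqP => [->|/eqP j0]; first by rewrite rmorph1 gam0 invr1.
  case: insubP => [i _ ei|].
    by rewrite rmorphM tv tg ei mulN1r opprK.
  rewrite -leqNgt => le_Qj; have -> : j = (p ^ m).-1 by rewrite pmQ; lia.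
  rewrite rmorphM rmorphN tv opprK mul1r tk gam_predX // natrX -exprVn.
  congr (_ ^+ _); apply: (@addrI _ 1); rewrite subrr; apply/esym.
  have : (p.-1)`!%:R = - 1 :> F.
    apply/eqP; rewrite -addr_eq0 natr1 -(dvdn_pcharf charF).
    by rewrite -Wilson.
  by move=> ->; rewrite invrN1 subrr.
rewrite pmQ big_ord_recr /= cQ; have [->|nz] := eqVneq y 0.
  rewrite add_char0 T0 expr0n gtn_eqF // mulr0 addr0.
  rewrite (bigD1 (Ordinal Q_gt0)) //= digit_total0 c0 !mul1r expr0.
  rewrite big1 ?addr0 // => j; rewrite -val_eqE /= => j0.
  by rewrite expr0n (negPf j0) mulr0.
rewrite T_expQ // mulr1.
(* orthogonality of the characters T^j of F^* *)
have geom z : z != 0 -> \sum_(j < Q) T z ^+ j = if z == 1 then Q%:R else 0.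
  move=> z0; case: eqP => [->|/eqP z1].
    rewrite (eq_bigr (fun=> 1)) => [|j _]; last by rewrite T1 expr1n.
    by rewrite sumr_const card_ord.
  by apply: (T_sub1_reg z1); rewrite -subrX1 T_expQ // subrr.
have total : \sum_(j < Q) gauss_sum j * T y ^+ j = Q%:R * add_char y.
  under eq_bigr => j _ do rewrite /gauss_sum big_distrl /=.
  rewrite exchange_big /= (bigD1 0) //= big1 => [|j _]; last first.
    by rewrite T0 expr0n subn_eq0 leqNgt ltn_ord !mul0r.
  rewrite add0r (eq_bigr (fun t => add_char t * \sum_(j < Q) T (y / t) ^+ j)); last first.
    move=> t t0; rewrite big_distrr /=; apply: eq_bigr => j _.
    have : T y ^+ j = T (y / t) ^+ j * T t ^+ j by rewrite -exprMn -TM divfK.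
    move=> ->; rewrite mulrAC -[RHS]mulr1 -(T_expQ t0).
    by have -> : T t ^+ Q = T t ^+ (Q - j) * T t ^+ j;
      [rewrite -exprD subnK // ltnW | ring].
  rewrite (bigD1 y) //= geom ?mulf_neq0 ?invr_eq0 // divff // eqxx mulrC.
  rewrite big1 ?addr0 // => t /andP[t0 ty]; rewrite geom ?mulf_neq0 ?invr_eq0 //.
  by rewrite -(inj_eq (mulIf t0)) divfK // mul1r eq_sym (negPf ty) mulr0.
rewrite -[LHS]mul1r -{1}ev mulrAC -total.
rewrite (bigD1 (Ordinal Q_gt0)) //= [in RHS](bigD1 (Ordinal Q_gt0)) //=.
rewrite !expr0 gauss_sum0 digit_total0 expr0 c0 !mulr1. rewrite -natr1.
rewrite mulrDl [in LHS]big_distrl /=.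
have -> : \sum_(j < Q | j != Ordinal Q_gt0) gauss_sum j * T y ^+ j * v
   = \sum_(j < Q | j != Ordinal Q_gt0) lam ^+ digit_total p m j * c j * T y ^+ j.
  apply: eq_bigr => j; rewrite -val_eqE /= -lt0n => j0.
  by rewrite cE //; ring.
rewrite [RHS]addrAC; congr (_ + _).
have -> : - v * (Q%:R + 1) = - (Q%:R * v) - v by ring.
by rewrite ev; ring.
Qed.

End RamifiedLift.

(** * Construction of the local ring *)

Section QuotientEvaluation.
Import Pdiv.CommonRing Pdiv.RingMonic.
Variables (A S : comNzRingType) (phi : {rmorphism A -> S}) (h : {poly A}) (z : S).
Hypotheses (h_monic : h \is monic) (h_size : (1 < size h)%N).
Hypothesis h_root : (map_poly phi h).[z] = 0.

(** The proofs are arguments so that the ring morphism structure can be attached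
    to the evaluation, which is compatible with products only if z is a
    root. *)
Definition qpoly_eval of (h \is monic) & (1 < size h)%N & (map_poly phi h).[z] = 0
  := fun x : {poly %/ h} => (map_poly phi (x : {poly A})).[z].

Local Notation ev := (qpoly_eval h_monic h_size h_root).

Lemma mk_monicE : mk_monic h = h.
Proof. by rewrite /mk_monic h_size h_monic. Qed.

Lemma qpoly_eval_in (P : {poly A}) : ev (in_qpoly h P) = (map_poly phi P).[z].
Proof.
rewrite /qpoly_eval /in_qpoly /= mk_monicE [in RHS](rdivp_eq h_monic P).
by rewrite rmorphD rmorphM hornerD hornerM h_root mulr0 add0r.
Qed.

Fact qpoly_eval_is_zmod : zmod_morphism ev.
Proof. by move=> x y; rewrite /qpoly_eval rmorphB hornerD hornerN. Qed.

Fact qpoly_eval_is_monoid : monoid_morphism ev.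
Proof.
split; first by rewrite -(in_qpoly1 h) qpoly_eval_in rmorph1 hornerC.
move=> x y; rewrite -[x * y]/(in_qpoly h ((x : {poly A}) * y)) qpoly_eval_in.
by rewrite rmorphM hornerM.
Qed.

HB.instance Definition _ := GRing.isZmodMorphism.Build {poly %/ h} S ev qpoly_eval_is_zmod.
HB.instance Definition _ := GRing.isMonoidMorphism.Build {poly %/ h} S ev qpoly_eval_is_monoid.

Lemma qpoly_eval_rmorphism : exists theta : {rmorphism {poly %/ h} -> S},
  forall P, theta (in_qpoly h P) = (map_poly phi P).[z].
Proof. by exists ev; exact: qpoly_eval_in. Qed.

Lemma in_qpoly_val (x : {poly %/ h}) : in_qpoly h (x : {poly A}) = x.
Proof. by apply: val_inj; rewrite /= rmodp_small ?size_mk_monic. Qed.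

End QuotientEvaluation.

Lemma qpoly_natr_eq0 (A : comNzRingType) (h : {poly A}) k :
  k%:R = 0 :> {poly %/ h} -> k%:R = 0 :> A.
Proof.
move=> /(congr1 val) /=; rewrite qpolyC_natr /= -polyC_natr.
by move=> /(congr1 (fun P : {poly A} => P`_0)); rewrite coefC coef0.
Qed.

Section ZpToField.
Variables (p N : nat) (F : finFieldType).
Hypotheses (p_prime : prime p) (charF : p \in [pchar F]) (N_gt0 : (0 < N)%N).

Let pN_gt1 : (1 < p ^ N)%N.
Proof. by rewrite -(exp1n N) ltn_exp2r // prime_gt1. Qed.

Lemma natr_mod_Zp n : (n %% (Zp_trunc (p ^ N)).+2)%N%:R = n%:R :> F.
Proof.
rewrite Zp_cast //.
rewrite [in RHS](divn_eq n (p ^ N)) natrD natrM.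
have /eqP -> : (p ^ N)%:R == 0 :> F by rewrite -(dvdn_pcharf charF) dvdn_exp.
by rewrite mulr0 add0r.
Qed.

Definition Zp_to_field of prime p & p \in [pchar F] & (0 < N)%N :=
  fun x : 'Z_(p ^ N) => (x : nat)%:R : F.

Local Notation phi := (Zp_to_field p_prime charF N_gt0).

Fact Zp_to_field_is_nmod : nmod_morphism phi.
Proof.
by split=> // x y; rewrite /Zp_to_field -natrD -[RHS]natr_mod_Zp.
Qed.

Fact Zp_to_field_is_monoid : monoid_morphism phi.
Proof.
split; first by rewrite /Zp_to_field /= modn_small.
by move=> x y; rewrite /Zp_to_field -natrM -[RHS]natr_mod_Zp.
Qed.

HB.instance Definition _ := GRing.isNmodMorphism.Build 'Z_(p ^ N) F phi Zp_to_field_is_nmod.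
HB.instance Definition _ := GRing.isMonoidMorphism.Build 'Z_(p ^ N) F phi Zp_to_field_is_monoid.

Lemma Zp_to_field_rmorphism : exists phi : {rmorphism 'Z_(p ^ N) -> F},
  (forall x, exists n, phi x = n%:R) /\ (forall x, phi x = 0 -> exists y, x = p%:R * y).
Proof.
exists phi; split=> x; first by exists x.
rewrite /= /Zp_to_field => /eqP; rewrite -(dvdn_pcharf charF) => /dvdnP[k ek].
by exists k%:R; rewrite -natrM mulnC -ek natr_Zp.
Qed.

Lemma Zp_natr_eq0 k : (k%:R == 0 :> 'Z_(p ^ N)) = (p ^ N %| k)%N.
Proof. by rewrite -val_eqE /= val_Zp_nat. Qed.

End ZpToField.

Section Existence.
Variables (p N : nat) (F : finFieldType).
Hypotheses (p_prime : prime p) (charF : p \in [pchar F]) (N_gt0 : (0 < N)%N).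

Let p_gt1 : (1 < p)%N. Proof. exact: prime_gt1. Qed.

(** The ring (Z / p^N)[zeta], totally ramified over Z / p^N: its residue map
    evaluates polynomials in lam = zeta - 1 at 0. *)
Lemma eisenstein_ring : exists (B : comNzRingType) (theta : {rmorphism B -> F}) (lam : B),
  [/\ forall x, exists n, theta x = n%:R,
      forall x, theta x = 0 -> exists y, x = lam * y,
      theta lam = 0, \sum_(i < p) (1 + lam) ^+ i = 0
    & forall k, k%:R = 0 :> B <-> (p ^ N %| k)%N].
Proof.
have [phi [phi_nat phi_ker]] := Zp_to_field_rmorphism p_prime charF N_gt0.
set A := 'Z_(p ^ N) in phi phi_nat phi_ker.
pose h : {poly A} := \poly_(k < p) ('C(p, k.+1))%:R.
have lead1 : ('C(p, p.-1.+1))%:R != 0 :> A.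
  by rewrite prednK ?prime_gt0 // binn oner_neq0.
have h_size : size h = p.
  by rewrite /h size_poly_eq.
have h_monic : h \is monic.
  rewrite monicE lead_coefE h_size coef_poly ltn_predL prime_gt0 //.
  by rewrite prednK ?prime_gt0 // binn.
have h_gt1 : (1 < size h)%N by rewrite h_size.
have h_root : (map_poly phi h).[0] = 0.
  rewrite horner_coef0 coef_map /= coef_poly prime_gt0 // bin1 rmorph_nat.
  by apply/eqP; rewrite -(dvdn_pcharf charF).
have [theta thetaE] := qpoly_eval_rmorphism h_monic h_gt1 h_root.
pose lam : {poly %/ h} := in_qpoly h 'X.
have lam_cyc : \sum_(i < p) (1 + lam) ^+ i = 0.
  have -> : \sum_(i < p) (1 + lam) ^+ i = in_qpoly h (\sum_(i < p) (1 + 'X) ^+ i).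
    rewrite rmorph_sum; apply: eq_bigr => i _.
    by rewrite rmorphXn rmorphD rmorph1.
  have -> : \sum_(i < p) (1 + 'X) ^+ i = h.
    rewrite sum_geom_binomial /h poly_def; apply: eq_bigr => i _.
    by rewrite scaler_nat.
  by apply: val_inj; rewrite /= mk_monicE // Pdiv.RingMonic.rmodpp.
have [w ew] := cyclotomic_dvd_p p_prime lam_cyc.
exists {poly %/ h}, theta, lam; split=> //.
- move=> x; rewrite -(in_qpoly_val x) thetaE horner_coef0 coef_map; exact: phi_nat.
- move=> x; rewrite -{1}(in_qpoly_val x) thetaE horner_coef0 coef_map /= => /phi_ker[y ey].
  exists (w * in_qpoly h y%:P
    + in_qpoly h (\poly_(i < (size (x : {poly A})).-1) (x : {poly A})`_i.+1)).
  rewrite mulrDr mulrA -ew -{1}(in_qpoly_val x) -(rmorph_nat (in_qpoly h)).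
  rewrite -!rmorphM -rmorphD; congr in_qpoly; apply/polyP => i.
  rewrite -polyC_natr -polyCM -ey coefD coefC coefXM.
  case: i => [|i]; first by rewrite addr0.
  rewrite add0r coef_poly /=; case: ltnP => // le_i.
  by rewrite nth_default // (leq_trans (leqSpred _)).
- by rewrite thetaE map_polyX hornerX.
move=> k; split=> [/qpoly_natr_eq0 e|dv]; first by rewrite -Zp_natr_eq0 // e.
have e : k%:R = 0 :> A by apply/eqP; rewrite Zp_natr_eq0.
by rewrite -(rmorph_nat (qpolyC h)) e rmorph0.
Qed.

Lemma prime_subfield_div (a b : nat) : exists n : 'I_p, a%:R / b%:R = n%:R :> F.
Proof.
apply: (prime_subfield p_prime charF).
by rewrite exprMn exprVn -!(pFrobenius_autE charF) !pFrobenius_aut_nat.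
Qed.

(** The minimal polynomial of g over the prime field, written with natural
    coefficients so that it can be lifted to other rings. *)
Lemma minimal_relation (g : F) : g != 0 -> exists s (e : 'I_s -> nat),
  [/\ (0 < s)%N, g ^+ s + \sum_(i < s) (e i)%:R * g ^+ i = 0
    & forall P : {poly F}, (forall i, exists n, P`_i = n%:R) ->
        (size P <= s)%N -> P.[g] = 0 -> P = 0].
Proof.
move=> g0; pose rel s := [exists e : {ffun 'I_s -> 'I_p},
  g ^+ s + \sum_(i < s) (e i)%:R * g ^+ i == 0].
have ex_rel : exists s, rel s.
  exists #|F|.-1; apply/existsP; have Q0 : (0 < #|F|.-1)%N.
    by rewrite -subn1 subn_gt0 finNzRing_gt1.
  have [c ec] : exists c : 'I_p, -1 = c%:R :> F.
    apply: (prime_subfield p_prime charF).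
    by rewrite -(pFrobenius_autE charF) rmorphN1.
  (* The set of relations is nonempty, as g^(q-1) = 1. *)
  pose z0 : 'I_p := Ordinal (prime_gt0 p_prime).
  exists [ffun i => if i == Ordinal Q0 then c else z0].
  rewrite nonzero_expf_card1 // (bigD1 (Ordinal Q0)) //= ffunE eqxx expr0 mulr1.
  rewrite -ec big1 ?addr0 ?subrr // => i ni.
  by rewrite ffunE (negPf ni) mul0r.
have [s /existsP[e /eqP es] s_min] := ex_minnP ex_rel.
exists s, (fun i => e i : nat); split=> //.
  case: s e es {s_min} => // e; rewrite big_ord0 addr0 expr0 => /eqP.
  by rewrite oner_eq0.
move=> P P_nat le_Ps Pg; apply/eqP; apply: contraT => P0; exfalso.
have [t eS] : exists t, size P = t.+1.
  by exists (size P).-1; rewrite prednK // size_poly_gt0.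
(* Dividing P by its leading coefficient, which is prime to p, would give a
   relation of degree t < s. *)
suff /s_min : rel t by rewrite leqNgt -eS le_Ps.
have [b eb] := P_nat t.
have b0 : b%:R != 0 :> F.
  by rewrite -eb; move: P0; rewrite -lead_coef_eq0 lead_coefE eS.
have /fin_all_exists[f ef] (i : 'I_t) : exists n : 'I_p, P`_i / b%:R = n%:R.
  by have [c ->] := P_nat i; apply: prime_subfield_div.
apply/existsP; exists (finfun f); apply/eqP.
apply: (mulIf b0); rewrite mul0r -[RHS]Pg horner_coef mulrDl.
rewrite eS big_ord_recr /= eb [LHS]addrC; congr (_ + _); last exact: mulrC.
rewrite big_distrl /=; by apply: eq_bigr => i _; rewrite ffunE -ef mulrAC divfK.
Qed.

Lemma exists_finfield_generator :
  exists2 g : F, g != 0 & forall z : F, z != 0 -> exists k, z = g ^+ k.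
Proof.
have /cyclicP[u eu] := field_unit_group_cyclic [set: {unit F}].
exists (val u) => [|z nz]; first by rewrite -unitfE (valP u).
have : finField_unit nz \in <[u]>%g by rewrite -eu inE.
case/cycleP => k ek; exists k.
by rewrite -[z]/(val (finField_unit nz)) ek FinRing.val_unitX.
Qed.

(** Adjoin to B = (Z / p^N)[zeta] a root of a lift of the minimal polynomial of
    a generator g of F^*, and map that root to g.  An element of the kernel is
    a polynomial of smaller degree whose reduction vanishes at g; by minimality
    the reduction is 0, so all its coefficients are divisible by lam. *)
Theorem ramified_lift_exists :
  exists (O : comNzRingType) (theta : {rmorphism O -> F}) (lam : O),
  [/\ forall a, exists x, theta x = a,
      forall x, theta x = 0 -> exists y, x = lam * y,
      lam ^+ (p.-1 * N) = 0, \sum_(i < p) (1 + lam) ^+ i = 0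
    & forall k, k%:R = 0 :> O -> (p ^ N %| k)%N].
Proof.
have [B [phi [lam [phi_nat phi_ker phi_lam lam_cyc natB]]]] := eisenstein_ring.
have [g g0 g_gen] := exists_finfield_generator.
have [s [e [s_gt0 eg g_min]]] := minimal_relation g0.
pose h : {poly B} := 'X^s + \poly_(i < s) (if insub i is Some j then e j else 0%N)%:R.
have le_s :
  (size (\poly_(i < s) (if insub i is Some j then e j else 0%N)%:R : {poly B})
    < size ('X^s : {poly B}))%N.
  by rewrite size_polyXn ltnS size_poly.
have h_size : size h = s.+1 by rewrite /h size_polyDl // size_polyXn.
have h_monic : h \is monic by rewrite monicE /h lead_coefDl // lead_coefXn.
have h_gt1 : (1 < size h)%N by rewrite h_size.
have h_root : (map_poly phi h).[g] = 0.
  rewrite -[RHS]eg /h rmorphD /= map_polyXn hornerD hornerXn; congr (_ + _).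
  rewrite poly_def rmorph_sum horner_sum; apply: eq_bigr => i _.
  by rewrite valK /= map_polyZ /= map_polyXn hornerZ hornerXn rmorph_nat.
have [theta thetaE] := qpoly_eval_rmorphism h_monic h_gt1 h_root.
pose lamO := qpolyC h lam.
exists {poly %/ h}, theta, lamO; split.
- move=> z; have [->|/g_gen[k ->]] := eqVneq z 0; first by exists 0; rewrite rmorph0.
  by exists (in_qpoly h 'X^k); rewrite thetaE map_polyXn hornerXn.
- move=> x; rewrite -{1}(in_qpoly_val x) thetaE => xg.
  have coef0 i : phi (x : {poly B})`_i = 0.
    rewrite -coef_map /=; suff -> : map_poly phi x = 0 by rewrite coef0.
    apply: g_min xg => [j|].
      by rewrite coef_map; apply: phi_nat.
    apply: leq_trans (size_poly _ _) _.
    by rewrite -ltnS; apply: leq_trans (size_mk_monic x) _; rewrite mk_monicE // h_size.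
  have /fin_all_exists[y ey] (i : 'I_(size (x : {poly B}))) := phi_ker _ (coef0 i).
  pose P := \poly_(i < size (x : {poly B})) (if insub i is Some j then y j else 0).
  exists (in_qpoly h P); rewrite -[lamO](in_qpoly_val lamO) -rmorphM.
  rewrite -[LHS](in_qpoly_val x); congr in_qpoly; apply/polyP => i.
  rewrite /lamO qpolyCE coefCM coef_poly; case: ltnP => [lt_i|ge_i].
    by rewrite insubT -ey.
  by rewrite mulr0 nth_default.
- rewrite /lamO -rmorphXn cyclotomic_nilpotent ?rmorph0 //.
  by apply/natB.
- have -> : \sum_(i < p) (1 + lamO) ^+ i = qpolyC h (\sum_(i < p) (1 + lam) ^+ i).
    rewrite rmorph_sum; apply: eq_bigr => i _.
    by rewrite rmorphXn rmorphD rmorph1.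
  by rewrite lam_cyc rmorph0.
by move=> k /qpoly_natr_eq0 /natB.
Qed.

End Existence.

(** * The order in lam of each contribution *)

Lemma ceil_div_bounds (n d : nat) : (0 < d)%N ->
  (n <= ceil_div n d * d < n + d)%N.
Proof.
move=> d_gt0; rewrite /ceil_div.
have := divn_eq (n + d.-1) d; have := ltn_pmod (n + d.-1) d_gt0.
by move: (_ %/ _)%N (_ %% _)%N => x y; lia.
Qed.

Lemma ceil_div_gt0 (n d : nat) : (0 < n)%N -> (0 < d)%N -> (0 < ceil_div n d)%N.
Proof.
by move=> n_gt0 /(ceil_div_bounds n); case: ceil_div => //; case: n n_gt0.
Qed.

Section Exponents.
Local Open Scope nat_scope.
Variables (p m n d : nat).
Hypotheses (p_gt1 : 1 < p) (m_gt0 : 0 < m) (n_gt0 : 0 < n) (d_gt1 : 1 < d).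

Implicit Type i : {ffun expts n d -> 'I_(p ^ m)}.

Definition exp_sum i := \sum_u i u.
Definition weight i := \sum_u digit_total p m (i u).
Definition nzero i := \sum_(k < n) (wsum i k == 0).
(** The order in lam of the contribution of i to q |Z(f)|: the digit sums come
    from the Gauss sums, and each vanishing exponent produces a factor
    q, of order m (p - 1). *)
Definition lam_order i := weight i + m * p.-1 * (nzero i + (exp_sum i == 0)).

Lemma total_digits i : exp_sum i = \sum_(j < m) digit_sum p i j * p ^ j.
Proof.
rewrite /exp_sum (eq_bigr _ (fun u _ => digits_sum p_gt1 (ltn_ord (i u)))).
by rewrite exchange_big; apply: eq_bigr => j _; rewrite big_distrl.
Qed.

Lemma weight_digits i : weight i = \sum_(j < m) digit_sum p i j.
Proof. by rewrite /weight exchange_big. Qed.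

Lemma total_const i s : (forall j : 'I_m, digit_sum p i j = p.-1 * s) ->
  exp_sum i = s * (p ^ m).-1 /\ weight i = m * p.-1 * s.
Proof.
move=> dE; split.
  rewrite total_digits predn_exp mulnCA mulnA big_distrr /=.
  by apply: eq_bigr => j _; rewrite dE.
rewrite weight_digits (eq_bigr (fun=> p.-1 * s)) => [|j _]; last exact: dE.
by rewrite sum_nat_const card_ord mulnA.
Qed.

Lemma nzero_card i : #|[set k | 0 < wsum i k]| + nzero i = n.
Proof.
rewrite /nzero -sum1dep_card big_mkcond /= -big_split /= -[RHS]card_ord -sum1_card.
by apply: eq_bigr => k _; case: (wsum i k).
Qed.

Lemma I_setP i : i \in I_set p m n d ->
  [/\ (p ^ m).-1 %| exp_sum i, 0 < exp_sum i,
      forall k, 0 < wsum i k /\ (p ^ m).-1 %| wsum i k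
    & lam_order i = m * p.-1 * ceil_div n d].
Proof.
rewrite inE => /andP[/forallP wP /forallP dP].
have [eT eW] := total_const (fun j => eqP (dP j)).
have Q_gt0 : 0 < (p ^ m).-1 by have := ltn_expl m p_gt1; lia.
have c_gt0 : 0 < ceil_div n d by rewrite ceil_div_gt0 // ltnW.
have T_gt0 : 0 < exp_sum i by rewrite eT muln_gt0 c_gt0.
split=> //; [by rewrite eT dvdn_mull | by move=> k; apply/andP/wP |].
rewrite /lam_order eW (gtn_eqF T_gt0) /nzero big1 => [|k _]; first by rewrite muln0 addn0.
by have /andP[/gtn_eqF->] := wP k.
Qed.

Lemma I'_setP i : i \in I'_set p m n d ->
  [/\ (p ^ m).-1 %| exp_sum i, 0 < exp_sum i,
      exists2 k, wsum i k = 0 &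
        forall l, l != k -> 0 < wsum i l /\ (p ^ m).-1 %| wsum i l
    & lam_order i = m * p.-1 * ceil_div n d].
Proof.
rewrite inE => /and4P[/dvdnP[s es] /existsP[u nzu] /existsP[k /andP[/eqP wk /forallP wP]]].
move=> /forallP dP; have [eT eW] := total_const (fun j => eqP (dP j)).
have T_gt0 : 0 < exp_sum i by rewrite /exp_sum (bigD1 u) //= ltn_addr // lt0n.
have wP' l : l != k -> 0 < wsum i l /\ (p ^ m).-1 %| wsum i l.
  by move=> lk; apply/andP; have := wP l; rewrite lk.
split=> //; [by rewrite eT dvdn_mull | by exists k |].
rewrite /lam_order eW (gtn_eqF T_gt0) /nzero (bigD1 k) //= wk eqxx big1 => [|l lk].
  rewrite -mulnDr !addn0; congr (_ * _).
  have := ceil_div_bounds n (ltnW d_gt1); rewrite es mulnK ?(ltnW d_gt1) //.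
  by move: (ceil_div n d) => c; nia.
by have [/gtn_eqF->] := wP' l lk.
Qed.

Lemma I_I'_disjoint i : i \in I_set p m n d -> i \in I'_set p m n d -> False.
Proof.
move=> /I_setP[_ _ wP _] /I'_setP[_ _ [k wk _] _].
by have [] := wP k; rewrite wk.
Qed.

(** Let z be the number of vanishing components, so that r = n - z are
    positive.  The digit sums add up to at least m (p-1) rho with
    rho = max(1, ceil(r/d)), and rho + z >= ceil(n/d).  As d >= 2, equality
    leaves only z = 0, or z = 1 with d dividing n - 1. *)
Lemma lam_order_bound i :
  (p ^ m).-1 %| exp_sum i -> (forall k, (p ^ m).-1 %| wsum i k) ->
  m * p.-1 * ceil_div n d <= lam_order i /\
  (lam_order i = m * p.-1 * ceil_div n d ->
     i \in I_set p m n d \/ i \in I'_set p m n d).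
Proof.
move=> dvdT dvdw; have mp_gt0 : 0 < m * p.-1 by rewrite muln_gt0 m_gt0; lia.
have /andP[c_ge c_lt] := ceil_div_bounds n (ltnW d_gt1); set c := ceil_div n d in c_ge c_lt *.
have zE := nzero_card i; rewrite /lam_order.
have [T0|T_gt0] := posnP (exp_sum i).
  have -> : nzero i = n.
    rewrite -zE; apply/esym/eqP; rewrite -[X in _ == X]add0n eqn_add2r cards_eq0.
    apply/eqP/setP => k; rewrite !inE lt0n; apply/negbF.
    rewrite /wsum sum_nat_eq0; apply/forallP => u /=.
    by move/eqP: T0; rewrite sum_nat_eq0 => /forallP /(_ u) /= /eqP ->.
  have lt_c : m * p.-1 * c < m * p.-1 * (n + 1) by rewrite ltn_pmul2l //; nia.
  rewrite /=; split; first by apply: leq_trans (ltnW lt_c) (leq_addl _ _).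
  by move=> e; move: lt_c; rewrite -e ltnNge leq_addl.
rewrite addn0.
pose r := #|[set k | 0 < wsum i k]|.
(* rho = max(1, ceil(r / d)) *)
have [rho [rho_gt0 rho_ge rho_cond]] :
    exists rho, [/\ 0 < rho, r <= rho * d & rho <= 1 \/ rho.-1 * d < r].
  case: (posnP r) => [->|r_gt0]; first by exists 1; split=> //; left.
  have d_gt0 : 0 < d by apply: ltnW.
  exists (r.-1 %/ d).+1; split=> //.
    by rewrite mulSn -ltnS -{1}(prednK r_gt0) ltnS {1}(divn_eq r.-1 d);
       have := ltn_pmod r.-1 d_gt0; lia.
  by right; rewrite /= -{2}(prednK r_gt0) ltnS leq_trunc_div.
have w_le (u : expts n d) : \sum_(k < n) u k <= d.
  by have := bmdeg u; rewrite mdegE ltnS.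
have i_lt u : i u < p ^ m by [].
have bound := ax_bound p_gt1 m_gt0 i_lt w_le dvdT dvdw T_gt0 rho_cond.
have rho_z : c <= rho + nzero i.
  by rewrite -ltnS -(ltn_pmul2r (ltnW d_gt1)); move: zE; rewrite -/r; nia.
split.
  rewrite -/c; apply: leq_trans (leq_add bound (leqnn _)).
  by rewrite -mulnDr leq_mul2l rho_z orbT.
move=> e; have e_rho : rho + nzero i = c.
  apply/eqP; rewrite eqn_leq rho_z andbT -(leq_pmul2l mp_gt0) -e mulnDr.
  by rewrite leq_add2r.
have eW : weight i = m * p.-1 * rho.
  by move: e; rewrite -e_rho mulnDr => /addIn.
have eD := ax_bound_eq p_gt1 m_gt0 i_lt w_le dvdT dvdw T_gt0 rho_cond eW.
(* For z >= 2, (rho + z) d >= r + z d = n + z (d - 1) >= n + d, as d >= 2. *)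
have [z0|z1] : nzero i = 0 \/ nzero i = 1.
- by move: zE e_rho; rewrite -/r; case: (nzero i) => [|[|z]]; [left|right|nia].
- left; rewrite inE; apply/andP; split; apply/forallP; last first.
    by move=> j; rewrite -/c -e_rho z0 addn0; apply/eqP; apply: eD.
  move=> k; rewrite /pos_multiple dvdw andbT lt0n; move/eqP: z0.
  by rewrite sum_nat_eq0 => /forallP /(_ k) /=; rewrite eqb0.
right; rewrite inE; have e_n : n.-1 = rho * d.
  by move: zE e_rho; rewrite -/r z1; nia.
rewrite e_n mulnK ?(ltnW d_gt1) // dvdn_mull //=; apply/and3P; split.
- move: T_gt0; apply: contraLR; rewrite negb_exists => /forallP i0.
  rewrite -leqNgt /exp_sum big1 // => u _.
  by have := i0 u; rewrite negbK => /eqP.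
- have [k wk] : exists k, wsum i k == 0.
    apply/existsP; apply: contraPT z1; rewrite negb_exists => /forallP nz.
    by rewrite /nzero big1 // => k _; rewrite (negPf (nz k)).
  apply/existsP; exists k; rewrite wk; apply/forallP => l; apply/implyP => lk.
  rewrite /pos_multiple dvdw andbT lt0n; move: z1.
  rewrite /nzero (bigD1 k) //= wk (bigD1 l) //=.
  by case: (wsum i l == 0).
- by apply/forallP => j; apply/eqP; apply: eD.
Qed.

End Exponents.

(** * Expanding the number of zeros *)

Section Counting.
Variables (p m n d : nat) (F : finFieldType) (O : comNzRingType).
Variables (theta : {rmorphism O -> F}) (lam kap : O).
Hypotheses (p_gt1 : (1 < p)%N) (m_gt0 : (0 < m)%N) (n_gt0 : (0 < n)%N) (d_gt1 : (1 < d)%N).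
Hypothesis cardF : #|F| = (p ^ m)%N.
Hypothesis theta_lam0 : theta lam = 0.
Hypothesis qE : (p ^ m)%:R = lam ^+ (m * p.-1) * kap.
Hypothesis theta_kap : theta kap = (- 1) ^+ m.
Hypothesis theta_Q1 : theta (p ^ m).-1%:R = - 1.
Variables (T psi : F -> O) (c : nat -> O).
Hypotheses (T1 : T 1 = 1) (TM : forall x y, T (x * y) = T x * T y).
Hypothesis theta_T : forall x, theta (T x) = x.
Hypothesis sum_T : forall e, \sum_t T t ^+ e =
  if e == 0%N then (p ^ m)%:R else if ((p ^ m).-1 %| e)%N then (p ^ m).-1%:R else 0.
Hypothesis psi_prod : forall (I : finType) (g : I -> F), psi (\sum_u g u) = \prod_u psi (g u).
Hypothesis sum_psi : forall y, \sum_t psi (t * y) = if y == 0 then (p ^ m)%:R else 0.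
Hypothesis theta_c : forall j, (j < p ^ m)%N -> theta (c j) = (gam p m j)%:R^-1.
Hypothesis psi_expansion : forall y,
  psi y = \sum_(j < p ^ m) lam ^+ digit_total p m j * c j * T y ^+ j.
Variable a : expts n d -> F.

Lemma eval_poly_of (x : 'I_n -> F) :
  (poly_of a).@[x] = \sum_(u : expts n d) a u * \prod_k x k ^+ u k.
Proof.
rewrite /poly_of raddf_sum /=; apply: eq_bigr => u _.
by rewrite mevalZ mevalX.
Qed.

Lemma T_prod (I : finType) (g : I -> F) : T (\prod_k g k) = \prod_k T (g k).
Proof. exact: (big_morph _ TM T1). Qed.

Let S e := \sum_t T t ^+ e.

Definition expansion_term (i : {ffun expts n d -> 'I_(p ^ m)}) : O :=
  (\prod_u (lam ^+ digit_total p m (i u) * c (i u) * T (a u) ^+ i u))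
  * (S (exp_sum i) * \prod_k S (wsum i k)).

(** Orthogonality of psi detects the zeros; after expansion, each term is a
    product of functions of the single variables t and x_k. *)
Lemma card_zeros_expansion :
  (p ^ m)%:R * #|zeros (poly_of a)|%:R = \sum_i expansion_term i.
Proof.
transitivity (\sum_(x : {ffun 'I_n -> F}) \sum_t psi (t * (poly_of a).@[x])).
  under [RHS]eq_bigr => x _ do rewrite sum_psi.
  rewrite -big_mkcond /= sumr_const mulr_natr; congr (_ *+ _).
  by apply: eq_card => x; rewrite inE.
transitivity (\sum_(x : {ffun 'I_n -> F}) \sum_t
   \sum_(i : {ffun expts n d -> 'I_(p ^ m)})
   (\prod_u (lam ^+ digit_total p m (i u) * c (i u) * T (a u) ^+ i u))
   * (T t ^+ exp_sum i * \prod_k T (x k) ^+ wsum i k)).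
  apply: eq_bigr => x _; apply: eq_bigr => t _.
  rewrite eval_poly_of big_distrr psi_prod.
  under eq_bigr => u _ do rewrite psi_expansion.
  rewrite bigA_distr_bigA /=; apply: eq_bigr => i _.
  have -> : T t ^+ exp_sum i = \prod_u T t ^+ i u by rewrite /exp_sum expr_sum.
  have -> : \prod_k T (x k) ^+ wsum i k = \prod_u \prod_k T (x k) ^+ (i u * u k).
    rewrite exchange_big /=; apply: eq_bigr => k _; rewrite /wsum expr_sum //.
  rewrite -!big_split /=; apply: eq_bigr => u _.
  rewrite !TM T_prod !exprMn -!mulrA; congr (_ * (_ * _)).
  rewrite mulrCA; congr (_ * (_ * _)).
  rewrite -prodrXl; apply: eq_bigr => k _.
  by rewrite (mult_lift_exp T1 TM) -exprM mulnC.
under eq_bigr => x _ do rewrite exchange_big /=.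
rewrite exchange_big /=; apply: eq_bigr => i _.
under eq_bigr => x _ do rewrite -big_distrr /=.
rewrite -big_distrr /=; congr (_ * _).
rewrite bigA_distr_bigA /= big_distrr /=; apply: eq_bigr => x _.
by rewrite -big_distrl.
Qed.

Let sigma e := if e == 0%N then kap else (p ^ m).-1%:R.

Lemma T_sum_sigma e : ((p ^ m).-1 %| e)%N ->
  S e = lam ^+ (m * p.-1 * (e == 0%N)) * sigma e.
Proof.
move=> dv; rewrite /S sum_T dv /sigma; case: eqP => _.
  by rewrite muln1 qE.
by rewrite muln0 expr0 mul1r.
Qed.

Lemma theta_sigma e : theta (sigma e) = if e == 0%N then (- 1) ^+ m else - 1.
Proof. by rewrite /sigma; case: eqP. Qed.

Lemma expansion_term_order i :
  ((p ^ m).-1 %| exp_sum i)%N -> (forall k, ((p ^ m).-1 %| wsum i k)%N) ->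
  exists2 y, expansion_term i = lam ^+ lam_order i * y
    & theta y = E_term a i * (theta (sigma (exp_sum i)) * \prod_k theta (sigma (wsum i k))).
Proof.
move=> dvT dvw.
exists (\prod_u (c (i u) * T (a u) ^+ i u)
        * (sigma (exp_sum i) * \prod_k sigma (wsum i k))); last first.
  rewrite !rmorphM !rmorph_prod /E_term; congr (_ * _).
  apply: eq_bigr => u _; rewrite rmorphM rmorphXn theta_T theta_c //.
  by rewrite mulrC.
rewrite /expansion_term T_sum_sigma // (eq_bigr _ (fun k _ => T_sum_sigma (dvw k))).
under eq_bigr => u _ do rewrite -mulrA.
rewrite !big_split /= -!expr_sum -!big_distrr /=.
rewrite /lam_order /weight /nzero mulnDr !exprD; ring.
Qed.

Lemma expansion_term_leading i : exists2 y,
  expansion_term i = lam ^+ (m * p.-1 * ceil_div n d) * y &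
  theta y = if i \in I_set p m n d then (- 1) ^+ n.+1 * E_term a i
            else if i \in I'_set p m n d then (- 1) ^+ (n + m) * E_term a i
            else 0.
Proof.
have [/andP[dvT /forallP dvw]|ndv] :=
  boolP (((p ^ m).-1 %| exp_sum i)%N && [forall k, ((p ^ m).-1 %| wsum i k)%N]); last first.
  have nI : i \in I_set p m n d = false.
    apply/negbTE; apply: contra ndv => /(I_setP p_gt1 m_gt0 n_gt0 d_gt1)[-> _ wP _] /=.
    by apply/forallP => k; case: (wP k).
  have nI' : i \in I'_set p m n d = false.
    apply/negbTE; apply: contra ndv => /(I'_setP p_gt1 m_gt0 n_gt0 d_gt1)[-> _ [k wk wP] _] /=.
    apply/forallP => l; have [->|/wP[]//] := eqVneq l k.
    by rewrite wk dvdn0.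
  exists 0; last by rewrite nI nI' rmorph0.
  have S0 e : ~~ ((p ^ m).-1 %| e)%N -> S e = 0.
    move=> nde; rewrite /S sum_T (negPf nde); case: eqP nde => // ->.
    by rewrite dvdn0.
  rewrite mulr0 /expansion_term; move: ndv; rewrite negb_and negb_forall.
  case/orP => [/S0 ->|/existsP[k /S0 Sk]]; first by rewrite mul0r mulr0.
  by rewrite (bigD1 k) //= Sk mul0r !mulr0.
have [y0 -> ty0] := expansion_term_order dvT dvw.
have [le_K eq_K] := lam_order_bound p_gt1 m_gt0 n_gt0 d_gt1 dvT dvw.
exists (lam ^+ (lam_order i - m * p.-1 * ceil_div n d) * y0).
  by rewrite mulrA -exprD subnKC.
rewrite rmorphM rmorphXn theta_lam0 ty0.
case: ifPn => [iI|nI].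
  have [_ T_gt0 wP eK] := I_setP p_gt1 m_gt0 n_gt0 d_gt1 iI.
  rewrite eK subnn expr0 mul1r theta_sigma gtn_eqF // mulrC; congr (_ * _).
  rewrite (eq_bigr (fun=> - 1)) => [|k _]; last first.
    by rewrite theta_sigma gtn_eqF //; case: (wP k).
  by rewrite prodr_const card_ord -exprS.
case: ifPn => [iI'|nI'].
  have [_ T_gt0 [k wk wP] eK] := I'_setP p_gt1 m_gt0 n_gt0 d_gt1 iI'.
  rewrite eK subnn expr0 mul1r theta_sigma gtn_eqF // mulrC; congr (_ * _).
  rewrite (bigD1 k) //= theta_sigma wk eqxx.
  rewrite (eq_bigr (fun=> - 1)) => [|l lk]; last first.
    by rewrite theta_sigma gtn_eqF //; case: (wP l lk).
  rewrite prodr_const cardC1 card_ord mulrCA -exprS -exprD addnC; congr (_ ^+ (_ + _)).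
  by rewrite prednK.
have lt_K : (m * p.-1 * ceil_div n d < lam_order i)%N.
  rewrite ltn_neqAle le_K andbT; apply/eqP => /esym/eq_K[] iI.
    by rewrite iI in nI.
  by rewrite iI in nI'.
by rewrite expr0n subn_eq0 leqNgt lt_K mul0r.
Qed.

(** Modulo lam^(m (p-1) ceil(n/d) + 1) only I and I' contribute.  The factor
    (-1)^(m ceil(n/d)) is the residue of q^ceil(n/d) / lam^(m (p-1) ceil(n/d)). *)
Theorem card_zeros_leading : exists2 Y,
  (p ^ m)%:R * #|zeros (poly_of a)|%:R = lam ^+ (m * p.-1 * ceil_div n d) * Y
  & theta Y = (- 1) ^+ (m * ceil_div n d) * E_of p m a.
Proof.
have /fin_all_exists2[y ey ty] := expansion_term_leading.
exists (\sum_i y i).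
  by rewrite card_zeros_expansion (eq_bigr _ (fun i _ => ey i)) -big_distrr.
rewrite rmorph_sum (eq_bigr _ (fun i _ => ty i)) /E_of mulrA -exprD.
set X := - _ + _.
have -> : (- 1) ^+ (m * ceil_div n d + (n + m * ceil_div n d)) * X = (- 1) ^+ n * X.
  by rewrite addnCA exprD addnn -mul2n exprM sqrrN expr1n expr1n mulr1.
rewrite (bigID (mem (I_set p m n d))) /=.
rewrite (eq_bigr (fun i => (- 1) ^+ n.+1 * E_term a i)) => [|i ->//].
rewrite -big_distrr /= mulrDr; congr (_ + _).
  by rewrite exprS mulN1r mulNr mulrN.
rewrite mulrA -exprD [RHS]big_distrr /= big_mkcond [RHS]big_mkcond /=.
apply: eq_bigr => i _; case: (boolP (i \in I_set p m n d)) => //= iI.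
case: ifP => // /(I_I'_disjoint p_gt1 m_gt0 n_gt0 d_gt1 iI) [].
Qed.

End Counting.

(** * The theorem *)

(** The length N of O only has to exceed the order m ceil(n/d) of p in
    q |Z(f)|. *)
Theorem card_zeros_witness (p m n d : nat) (F : finFieldType)
  (p_prime : prime p) (m_gt0 : (0 < m)%N) (cardF : #|F| = (p ^ m)%N)
  (n_gt0 : (0 < n)%N) (d_gt1 : (1 < d)%N) (a : expts n d -> F) :
  exists2 b, #|zeros (poly_of a)| = ((p ^ m) ^ (ceil_div n d).-1 * b)%N
    & b%:R = E_of p m a.
Proof.
have p_gt1 := prime_gt1 p_prime.
have charF := card_finPcharP cardF p_prime.
set c := ceil_div n d; pose N := (m * c).+1.
have c_gt0 : (0 < c)%N by rewrite ceil_div_gt0 // ltnW.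
have [O [theta [lam [surj ker nil cyc natO]]]] :=
  ramified_lift_exists p_prime charF (isT : (0 < N)%N).
have th0 := theta_lam theta nil.
have [T [T0 T1 TM tT]] := teichmuller p_prime m_gt0 cardF surj ker nil cyc.
have /fin_all_exists[tr trE] := abs_trace_nat p_prime cardF.
have [kap ek tk] := q_ramified m theta p_prime nil cyc.
have [cf [cf_theta cf_exp]] :=
  add_char_expansion p_prime m_gt0 cardF surj ker nil cyc T0 T1 TM tT trE.
have tQ := theta_Q theta p_prime m_gt0 cardF.
have sT := T_sum surj ker nil T0 T1 TM tT.
have sp := sum_add_charM p_prime m_gt0 cardF cyc trE.
have ps := add_char_sum_family p_prime cardF cyc trE.
rewrite cardF in sT tQ.
have [Y eY tY] := card_zeros_leading p_gt1 m_gt0 n_gt0 d_gt1 th0 ek tk tQ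
  T1 TM tT sT ps sp cf_theta cf_exp a.
move: eY; rewrite -natrM -/c => eY.
have [] := natr_lam_descent p_prime cardF surj ker nil cyc natO (ltnSn (m * c))
  (y := Y) (a := (p ^ m * #|zeros (poly_of a)|)%N).
  by rewrite eY mulnAC mulnC mulnA.
move=> b eb tb; exists b.
  apply/eqP; rewrite -(eqn_pmul2l (_ : 0 < p ^ m)%N) ?expn_gt0 ?(ltnW p_gt1) //.
  by rewrite eb mulnA -expnS prednK // expnM.
have := tb; rewrite tY => /(congr1 (fun z => (- 1) ^+ (m * c) * z)).
by rewrite !mulrA -!expr2 sqrr_sign !mul1r.
Qed.

Theorem theorem2p4 (p m n d : nat) (F : finFieldType)
  (p_prime : prime p) (m_ge1 : (1 <= m)%N) (cardF : #|F| = (p ^ m)%N)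
  (n_ge1 : (1 <= n)%N) (d_ge2 : (2 <= d)%N) (a : expts n d -> F) :
  let q := (p ^ m)%N in
  let c := ceil_div n d in
  let Z := #|zeros (poly_of a)| in
  [/\ exists e : 'F_p, E_of p m a = (e : nat)%:R,
      forall e : int, e%:~R = E_of p m a ->
        (Z%:Z = (q ^ c.-1)%N%:Z * e %[mod (q ^ c.-1 * p)%N%:Z])%Z
    & le_val (m * c.-1 + 1) (padic_val p Z) <-> E_of p m a = 0].
Proof.
move=> q c Z.
have [b eZ eE] := card_zeros_witness p_prime m_ge1 cardF n_ge1 d_ge2 a.
have charF := card_finPcharP cardF p_prime.
have p_gt1 := prime_gt1 p_prime.
have qc_gt0 : (0 < q ^ c.-1)%N by rewrite !expn_gt0 (ltnW p_gt1).
split.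
- exists (b%:R : 'F_p); rewrite -eE val_Fp_nat //.
  by rewrite (GRing.natr_mod_pchar charF).
- move=> e; rewrite -eE => ee; rewrite /Z eZ -/q -/c PoszM.
  apply/eqP; rewrite eqz_mod_dvd -mulrBr PoszM dvdz_mul2l; last by rewrite -lt0n.
  have : ((b%:Z - e)%:~R : F) = 0 by rewrite rmorphB /= -pmulrn ee subrr.
  move: (_ - e) => z; rewrite dvdzE /= (dvdn_pcharf charF).
  case: z => k /=; rewrite ?NegzE ?mulrNz -pmulrn => /eqP //.
  by rewrite oppr_eq0.
have Zexp : (p ^ (m * c.-1 + 1) %| Z)%N = (p %| b)%N.
  by rewrite /Z eZ addn1 expnSr expnM -/q -/c dvdn_pmul2l.
have -> : (E_of p m a = 0) <-> (p %| b)%N.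
  by rewrite -eE (dvdn_pcharf charF); split=> /eqP.
rewrite -Zexp /padic_val; case: eqP => [->|/eqP Z0] /=; first by rewrite dvdn0.
by rewrite pfactor_dvdn // lt0n.
Qed.
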